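(* Let $k\in(0,k_{\max})$. Then $$V(k)=\max_{\theta_2<0}\ \max_{\theta_1\in\mathbb{R}}\frac{k+K(\theta_1,\theta_2)-\theta_1}{\theta_2}=\max_{\theta_2<0}\frac{k+G(\theta_2)}{\theta_2}$$ (in particular the maxima are attained). Moreover, with $b:=V(k)$: (a) a number $\theta_2$ is a maximiser for $\max_{\theta_2<0}\frac{k+G(\theta_2)}{\theta_2}$ if and only if it is a maximiser of $\theta_2 b-G(\theta_2)$ over $\theta_2\in\mathbb{R}$; (b) a pair $(\theta_1,\theta_2)$ attains the double maximum $\max_{\theta_2<0}\max_{\theta_1\in\mathbb{R}}\frac{k+K(\theta_1,\theta_2)-\theta_1}{\theta_2}$ if and only if it attains the maximum of $\theta_1+\theta_2 b-K(\theta_1,\theta_2)$ over $(\theta_1,\theta_2)\in\mathbb{R}^2$; (c) any such pair $(\theta_1,\theta_2)$ belongs to $\Theta$ and satisfies $\int p_{\theta_1,\theta_2}\,d\mu\le 1$.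
   Context: Setup. $\Omega$ is a set with a $\sigma$-algebra and a finite or $\sigma$-finite measure $\mu$; functions on $\Omega$ are measurable and equality of functions is meant $\mu$-a.e. The function $\beta:\Omega\times\mathbb{R}\to(-\infty,+\infty]$ is measurable in $r$ for each $s$; for each $r$, $\beta(r,\cdot)$ is finite, strictly convex and differentiable on $(0,+\infty)$, $\beta(r,0)=\lim_{s\downarrow0}\beta(r,s)$, and $\beta(r,s)=+\infty$ for $s<0$. Put $H(p):=\int_\Omega\beta(r,p(r))\,\mu(dr)$ for $p\ge0$. A density is a nonnegative function $p$ with $\int p\,d\mu=1$. $X:\Omega\to\mathbb{R}$ is measurable, $m$ and $M$ are its $\mu$-essential infimum and supremum, and $p_0$ is a density (the default density) for which $b_0:=\int Xp_0\,d\mu$ exists. Standing assumptions: $-\infty\le m<b_0<M\le+\infty$; $H(p)\ge H(p_0)=0$ for every density $p$; and $k_{\max}:=\lim_{b\downarrow m}F(b)>0$, where $$F(b):=\inf\Big\{H(p):\ p\ge 0,\ \int p\,d\mu=1,\ \int Xp\,d\mu=b\Big\}.$$ Also $$V(k):=\inf\Big\{\int Xp\,d\mu:\ p\ge 0,\ \int p\,d\mu=1,\ H(p)\le k\Big\}.$$ Conventions: $\inf\emptyset=+\infty$; the integrals defining $H$ and $K$ are set to $+\infty$ when not well defined. Conjugates. $\beta^*(r,\tau):=\sup_{s\in\mathbb{R}}(s\tau-\beta(r,s))$; primes on $\beta,\beta^*$ denote derivatives in the second variable, and $\beta'(r,0),\beta'(r,+\infty)$ are limits of $\beta'(r,s)$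 as $s\downarrow0$, $s\uparrow+\infty$. Put $$K(\theta_1,\theta_2):=\int\beta^*(r,\theta_1+\theta_2X(r))\,\mu(dr),\qquad G(\theta_2):=\inf_{\theta_1\in\mathbb{R}}[K(\theta_1,\theta_2)-\theta_1],$$ $\mathrm{dom}\,K:=\{K<+\infty\}$, $\Theta:=\{(\theta_1,\theta_2)\in\mathrm{dom}\,K:\ \theta_1+\theta_2X(r)<\beta'(r,+\infty)\ \mu\text{-a.e.}\}$, and for $(\theta_1,\theta_2)\in\Theta$, $p_{\theta_1,\theta_2}(r):=(\beta^* )'(r,\theta_1+\theta_2X(r))$. *)

(* Defs.v *)
From HB Require Import structures.
From mathcomp Require Import all_boot all_order all_algebra.
From mathcomp Require Import all_classical all_reals all_analysis.
From mathcomp Require Import measurable_realfun ess_sup_inf.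

Set Implicit Arguments.
Unset Strict Implicit.
Unset Printing Implicit Defensive.

Import Order.TTheory GRing.Theory Num.Theory.
Import numFieldNormedType.Exports.

Local Open Scope classical_set_scope.
Local Open Scope ring_scope.
Local Open Scope ereal_scope.

Section Maximisers.
Context {R : realType} {A : Type}.
Implicit Types (D : set A) (f : A -> \bar R).

Definition maximiser D f (x : A) : Prop :=
  D x /\ forall y, D y -> f y <= f x.

(* An attained maximum. *)
Definition is_max D f (v : \bar R) : Prop :=
  exists2 x, maximiser D f x & f x = v.

End Maximisers.

Section Integrand.
Context {T : Type} {R : realType}.
Implicit Types (beta : T -> R -> \bar R) (r : T).

(* [beta r s] is finite for [s > 0], so that the derivative of
   [fine \o beta r] at such an [s] is the genuine one; its values at [s <= 0]
   are irrelevant. *)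
Definition beta' beta r (s : R) : R := derive1 (fine \o beta r) s.

Definition beta'_pinfty beta r : \bar R :=
  lim ((beta' beta r s)%:E @[s --> +oo%R]).

Definition conj_beta beta r (tau : R) : \bar R :=
  ereal_sup [set (s * tau)%:E - beta r s | s in [set: R]].

(* Meaningful where [conj_beta beta r] is finite near [tau], in particular for
   [tau < beta'_pinfty beta r]. *)
Definition conj_beta' beta r (tau : R) : R :=
  derive1 (fine \o conj_beta beta r) tau.

End Integrand.

Record convex_integrand {d} {T : measurableType d} {R : realType}
    (beta : T -> R -> \bar R) : Prop := ConvexIntegrand {
  ci_measurable : forall s : R, measurable_fun [set: T] (beta ^~ s) ;
  ci_gtNy : forall (r : T) (s : R), -oo < beta r s ;
  ci_fin : forall (r : T) (s : R), (0 < s)%R -> beta r s \is a fin_num ;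
  ci_strictly_convex : forall (r : T) (x y t : R),
    (0 < x)%R -> (0 < y)%R -> x != y -> (0 < t < 1)%R ->
    beta r (t * x + (1 - t) * y)%R
      < t%:E * beta r x + (1 - t)%:E * beta r y ;
  ci_derivable : forall (r : T) (s : R), (0 < s)%R ->
    derivable (fine \o beta r) s 1 ;
  ci_at0 : forall r : T, beta r s @[s --> 0%R^'+] --> beta r 0%R ;
  ci_neg : forall (r : T) (s : R), (s < 0)%R -> beta r s = +oo }.

Section Model.
Context {d : measure_display} {T : measurableType d} {R : realType}.
Variable mu : {measure set T -> \bar R}.
Implicit Types (beta : T -> R -> \bar R) (X p : T -> R).

Definition integral_exists (f : T -> \bar R) : Prop :=
  \int[mu]_r f^\+ r < +oo \/ \int[mu]_r f^\- r < +oo.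

(* The library integral is [-oo] when both parts have infinite integral,
   whereas the convention for [H] and [K] is [+oo]. *)
Definition upper_integral (f : T -> \bar R) : \bar R :=
  if `[< integral_exists f >] then \int[mu]_r f r else +oo.

Definition density p : Prop :=
  [/\ measurable_fun [set: T] p,
      forall r, (0 <= p r)%R &
      \int[mu]_r (p r)%:E = 1].

Definition H beta p : \bar R := upper_integral (fun r => beta r (p r)).

Definition F beta X (b : R) : \bar R :=
  ereal_inf [set H beta p | p in
    [set p | density p /\ \int[mu]_r (X r * p r)%:E = b%:E]].

(* Densities for which the expectation of [X] is undefined are not candidates;
   infinite expectations are allowed. *)
Definition V beta X (k : R) : \bar R :=
  ereal_inf [set \int[mu]_r (X r * p r)%:E | p in
    [set p | [/\ density p, H beta p <= k%:E &
                 integral_exists (fun r => (X r * p r)%:E)]]].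

Definition ess_lb X : \bar R := ess_inf mu (EFin \o X).

Definition ess_ub X : \bar R := ess_sup mu (EFin \o X).

(* The limit of [F] from the right at [ess_lb X], which may be [-oo]; the
   [+oo] branch is a dummy. *)
Definition kmax beta X : \bar R :=
  match ess_lb X with
  | m%:E => lim (F beta X b @[b --> m^'+])
  | -oo => lim (F beta X b @[b --> -oo%R])
  | +oo => 0
  end.

Definition K beta X (t1 t2 : R) : \bar R :=
  upper_integral (fun r => conj_beta beta r (t1 + t2 * X r)%R).

Definition G beta X (t2 : R) : \bar R :=
  ereal_inf [set K beta X t1 t2 - t1%:E | t1 in [set: R]].

Definition Theta beta X : set (R * R) :=
  [set t | K beta X t.1 t.2 < +oo /\
    {ae mu, forall r, (t.1 + t.2 * X r)%:E < beta'_pinfty beta r}].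

Definition p_theta beta X (t : R * R) (r : T) : R :=
  conj_beta' beta r (t.1 + t.2 * X r)%R.

Definition dual_KV beta X (k t1 t2 : R) : \bar R :=
  (k%:E + K beta X t1 t2 - t1%:E) / t2%:E.

Definition dual_GV beta X (k t2 : R) : \bar R :=
  (k%:E + G beta X t2) / t2%:E.

End Model.

(* Main.v *)
Require Import Defs.
From HB Require Import structures.
From mathcomp Require Import all_boot all_order all_algebra.
From mathcomp Require Import all_classical all_reals all_analysis.
From mathcomp Require Import measurable_realfun ess_sup_inf.
From mathcomp Require Import ring lra.

(** The theorem is Lagrange duality for a convex problem whose two linear
    constraints fix the mass and the moment [\int X p] of a density, and whose
    convex constraint bounds its cost [H p].

    Weak duality is the Young inequality
    [p (t1 + t2 X) <= beta^* (t1 + t2 X) + beta p], integrated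
    ([weak_duality]). For strong duality the problem is relaxed to nonnegative
    functions of arbitrary mass for which all the integrals are finite
    ([admissible]). Two facts carry it.

    - The supremum of [t1 * mass p + t2 * moment p - cost p] over these
      functions is exactly [K t1 t2] ([K_ge], [K_le]): since the integrand is
      right-continuous, the conjugate is a supremum over positive rationals,
      and measurable selections among finitely many rationals, on sets of
      finite measure where nothing is unbounded, nearly attain it
      ([integral_sup_le]).

    - One affine constraint always has a multiplier as soon as it can be
      violated on both sides ([lagrange_multiplier]). Used for the moment and
      then for the mass ([dual_multipliers]), it yields a pair [(t1, t2)] with
      [K t1 t2 <= t1 + t2 * b - c] whenever every function of mass one and
      moment [b] costs at least [c]. The sides of the constraints are reached
      by [mass_lt1], [mass_gt1] and [moment_lt], which follow from the same
      interchange of supremum and integral with the cost left out.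

    Convexity of the set of admissible functions has to be proved
    ([admissible_of_le]): the cost of a mixture might be [-oo], and that is
    excluded only because [H] is nonnegative on densities.

    Applied at a point [b1] above the essential infimum with [k < F b1], which
    exists as [k < kmax], the multipliers give [b1 <= V k]. Then [V k] is a
    finite number [b] strictly between the essential infimum and the moment of
    the reference density, no density of moment [b] costs less than [k]
    ([V_lt]), and the multipliers at [b] attain [V k] ([V_dual_attained]).
    Since also [t1 + t2 * b - K t1 t2 <= k] for all pairs ([K_ge_value]), both
    sides of (a) and of (b) say that the pair satisfies
    [K t1 t2 = t1 + t2 * b - k], which forces [t2 < 0]. For each [t2] the
    infimum in [G] is attained, again by a multiplier ([K_minimum]). For (c),
    optimality in [t1] bounds the left difference quotients of [K] by one, and
    Fatou's lemma passes this to the left derivative of the conjugate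
    ([optimal_Theta]). *)

Set Implicit Arguments.
Unset Strict Implicit.
Unset Printing Implicit Defensive.

Import Order.TTheory GRing.Theory Num.Theory.
Import numFieldNormedType.Exports.

Local Open Scope classical_set_scope.
Local Open Scope ring_scope.
Local Open Scope ereal_scope.

(** * Sequences *)

Section PositiveRationals.
Context {R : realType}.

Definition posrat (n : nat) : R :=
  if unpickle n is Some q then (if (0 < q :> rat)%R then ratr q else 1%R)
  else 1%R.

Lemma posrat_gt0 n : (0 < posrat n)%R.
Proof.
rewrite /posrat; case: (unpickle n) => // q.
by case: ifPn => // q0; rewrite ltr0q.
Qed.

Lemma posrat_dense (x y : R) : (0 <= x)%R -> (x < y)%R ->
  exists n, (x < posrat n < y)%R.
Proof.
move=> x0 xy; have [q] := rat_in_itvoo xy.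
rewrite in_itv /= => /andP[xq qy]; exists (pickle q).
rewrite /posrat pickleK ifT ?xq//.
by rewrite -(ltr0q R) (le_lt_trans x0).
Qed.

End PositiveRationals.

Lemma cvg_shift_harmonic {R : realType} (s : R) :
  (s + n.+1%:R^-1)%R @[n --> \oo] --> s^'+.
Proof.
move=> A [e /= e0 sA].
have h0 : (n.+1%:R^-1 : R)%R @[n --> \oo] --> (0 : R)%R := cvg_harmonic.
move/cvgrPdist_lt : h0 => /(_ _ e0)[N _ HN].
exists N => // n /HN /= hn; apply: sA => /=.
  by rewrite opprD addNKr; rewrite sub0r in hn.
by rewrite ltrDl invr_gt0.
Qed.

Lemma le_limn_einf {R : realType} (a : \bar R) (u : (\bar R)^nat) :
  (\forall n \near \oo, a <= u n) -> a <= limn_einf u.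
Proof.
move=> [N _ HN]; rewrite limn_einf_lim; apply: lime_ge.
  exact: is_cvg_einfs.
near=> n; apply: le_ereal_inf_tmp => _ [m /= nm <-]; apply: HN => /=.
by apply: leq_trans nm; near: n; exists N.
Unshelve. all: by end_near. Qed.

Lemma cvg_diff_quotient {R : realType} (f : R -> R) (x : R) (u : nat -> R) :
  derivable f x 1 -> (forall n, u n != 0%R) -> u n @[n --> \oo] --> 0%R ->
  ((u n)^-1 * (f (u n + x) - f x))%R @[n --> \oo] --> derive1 f x.
Proof.
move=> df u0 cu.
have cu' : u n @[n --> \oo] --> 0^'%R.
  move=> A [e /= e0 HA].
  move/cvgrPdist_lt : cu => /(_ _ e0)[N _ HN]; exists N => // n /HN hn.
  exact: HA.
have cf : (h^-1 *: (f (h + x) - f x))%R @[h --> 0^'%R] --> derive1 f x.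
  have := df; rewrite /derivable /derive1.
  suff -> : (fun h : R => h^-1 *: ((f \o shift x) (h *: 1) - f x))%R =
      (fun h : R => h^-1 *: (f (h + x) - f x))%R by [].
  by apply/funext => h /=; rewrite /GRing.scale /= mulr1.
exact: cvg_comp cu' cf.
Qed.

(** * Convex integrands and their conjugates *)

Section Integrand.
Context {d : measure_display} {T : measurableType d} {R : realType}.
Variables (beta : T -> R -> \bar R) (r : T).
Hypothesis hbeta : convex_integrand beta.

Lemma beta_cvg (s : R) : (0 < s)%R -> beta r x @[x --> s] --> beta r s.
Proof.
move=> s0; have fs := ci_fin hbeta r s0.
rewrite -(fineK fs); apply/fine_cvgP; split.
  near=> x; apply: (ci_fin hbeta).
  by near: x; exact: lt_nbhsr.
exact/differentiable_continuous/derivable1_diffP/(ci_derivable hbeta).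
Unshelve. all: by end_near. Qed.

Lemma beta_cvg_right (s : R) : (0 <= s)%R ->
  beta r x @[x --> s^'+] --> beta r s.
Proof.
rewrite le_eqVlt => /orP[/eqP <-|s0]; first exact: (ci_at0 hbeta).
exact: cvg_at_right_filter (beta_cvg s0).
Qed.

Lemma fine_beta_cvg_right (s : R) : (0 <= s)%R -> beta r s \is a fin_num ->
  fine (beta r x) @[x --> s^'+] --> fine (beta r s).
Proof.
by move=> s0 fs; apply: fine_cvg; rewrite fineK//; exact: beta_cvg_right.
Qed.

(** Right-continuity lets the positive rationals replace all arguments in such
    a supremum, which makes the conjugate measurable in [r]. *)
Lemma le_sup_posrat (a l s : R) : (0 <= s)%R -> beta r s \is a fin_num ->
  (s * a - l * fine (beta r s))%:E <=
  ereal_sup (range (fun n =>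
    (posrat n * a - l * fine (beta r (posrat n)))%:E)).
Proof.
move=> s0 fs; set S := ereal_sup _.
pose f (x : R) : R := (x * a - l * fine (beta r x))%R.
have cf : f x @[x --> s^'+] --> f s.
  apply: cvgB; first by apply: cvgMr_tmp; exact: cvg_at_right_filter cvg_id.
  by apply: cvgMl_tmp; exact: fine_beta_cvg_right.
apply/lee_addgt0Pr => e e0.
move/cvgrPdist_lt : cf => /(_ _ e0)[del /= del0 Hdel].
have [|n /andP[sn nsd]] := @posrat_dense _ s (s + del)%R s0.
  by rewrite ltrDl.
have : (`|f s - f (posrat n)| < e)%R.
  apply: Hdel => //=; rewrite distrC gtr0_norm ?subr_gt0//.
  by rewrite ltrBlDl.
move=> /ltr_distlDr /ltW fsn.
have : (f (posrat n))%:E <= S by apply: ereal_sup_ubound; exists n.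
rewrite -(leeD2rE _ _ (_ : e%:E \is a fin_num))//; apply: le_trans.
rewrite -EFinD lee_fin; move: fsn; rewrite /f; lra.
Qed.

Lemma conj_betaE (tau : R) : conj_beta beta r tau =
  ereal_sup (range (fun n =>
    (posrat n * tau - 1 * fine (beta r (posrat n)))%:E)).
Proof.
apply/eqP; rewrite eq_le; apply/andP; split; apply: ub_ereal_sup.
  move=> _ [s _ <-].
  have [s0|s0] := leP 0%R s; last by rewrite (ci_neg hbeta)// leNye.
  have := ci_gtNy hbeta r s.
  have [fs _|] := boolP (beta r s \is a fin_num).
    have := le_sup_posrat tau 1 s0 fs.
    by rewrite mul1r EFinB fineK.
  by case: (beta r s) => //=; rewrite leNye.
move=> _ [n _ <-]; apply: ereal_sup_ubound; exists (posrat n) => //.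
rewrite mul1r EFinB fineK//; exact: (ci_fin hbeta) (posrat_gt0 n).
Qed.

Lemma young (s tau : R) : (s * tau)%:E - beta r s <= conj_beta beta r tau.
Proof. by apply: ereal_sup_ubound; exists s. Qed.

Lemma conj_beta_gtNy (tau : R) : -oo < conj_beta beta r tau.
Proof.
apply: lt_le_trans (young 1 tau).
by rewrite -(fineK (ci_fin hbeta r ltr01)) -EFinB ltNyr.
Qed.

Lemma conj_beta_le (s t : R) : (s <= t)%R ->
  conj_beta beta r s <= conj_beta beta r t.
Proof.
move=> st; rewrite !conj_betaE; apply: ub_ereal_sup => _ [n _ <-].
apply: le_trans (ereal_sup_ubound _); last by exists n.
rewrite lee_fin lerD2r ler_wpM2l//; exact/ltW/posrat_gt0.
Qed.

(** Up to the boundary point [0], where it need not be finite, the integrand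
    is convex: this passes from positive arguments to the limit. *)
Lemma beta_convex (x y t : R) : (0 <= x)%R -> (0 <= y)%R -> (0 <= t <= 1)%R ->
  beta r x \is a fin_num -> beta r y \is a fin_num ->
  beta r (t * x + (1 - t) * y)%R <=
    (t * fine (beta r x) + (1 - t) * fine (beta r y))%:E.
Proof.
move=> x0 y0 /andP[t0 t1] fx fy.
move: t0; rewrite le_eqVlt => /orP[/eqP <-|t0].
  by rewrite !mul0r !add0r subr0 !mul1r fineK.
move: t1; rewrite le_eqVlt => /orP[/eqP ->|t1].
  by rewrite subrr !mul0r !addr0 !mul1r fineK.
have [->|xy] := eqVneq x y.
  by rewrite -!mulrDl addrC subrK !mul1r fineK.
pose e n : R := n.+1%:R^-1%R.
have e0 n : (0 < e n)%R by rewrite invr_gt0.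
have z0 : (0 <= t * x + (1 - t) * y)%R.
  by rewrite addr_ge0// mulr_ge0// ?subr_ge0 ltW.
have cv s : (0 <= s)%R -> beta r (s + e n)%R @[n --> \oo] --> beta r s.
  by move=> s0; exact: cvg_comp (@cvg_shift_harmonic R s) (beta_cvg_right s0).
have cvf s : (0 <= s)%R -> beta r s \is a fin_num ->
    fine (beta r (s + e n)%R) @[n --> \oo] --> fine (beta r s).
  by move=> s0 fs; apply: fine_cvg; rewrite fineK//; exact: cv.
have cg : (t * fine (beta r (x + e n)%R)
      + (1 - t) * fine (beta r (y + e n)%R))%:E @[n --> \oo] -->
    (t * fine (beta r x) + (1 - t) * fine (beta r y))%:E.
  apply: cvg_EFin; first by near=> n.
  apply: cvgD; apply: cvgMl_tmp; [exact: cvf x0 fx|exact: cvf y0 fy].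
apply: (lee_cvg_to (cv _ z0) cg); near=> n.
have xe : (0 < x + e n)%R by rewrite ltr_wpDl.
have ye : (0 < y + e n)%R by rewrite ltr_wpDl.
have := ci_strictly_convex hbeta r xe ye.
move=> /(_ t); rewrite t0 t1 => /(_ _ isT) h.
rewrite EFinD !EFinM !fineK; try exact: (ci_fin hbeta).
apply/ltW; apply: le_lt_trans (h _).
  by rewrite le_eqVlt; apply/orP; left; apply/eqP; congr (beta r _); ring.
by apply: contra_neq xy => /addIr.
Unshelve. all: by end_near. Qed.

Lemma beta_mix_fin (x y t : R) : (0 <= x)%R -> (0 <= y)%R -> (0 <= t <= 1)%R ->
  beta r x \is a fin_num -> beta r y \is a fin_num ->
  beta r (t * x + (1 - t) * y)%R \is a fin_num.
Proof.
move=> x0 y0 t01 fx fy; rewrite fin_numE gt_eqF ?(ci_gtNy hbeta)//= lt_eqF//.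
by apply: le_lt_trans (beta_convex x0 y0 t01 fx fy) _; rewrite ltry.
Qed.

Lemma fine_beta_convex (x y t : R) :
  (0 <= x)%R -> (0 <= y)%R -> (0 <= t <= 1)%R ->
  beta r x \is a fin_num -> beta r y \is a fin_num ->
  (fine (beta r (t * x + (1 - t) * y)%R) <=
   t * fine (beta r x) + (1 - t) * fine (beta r y))%R.
Proof.
by move=> *; rewrite -lee_fin fineK; [exact: beta_convex|exact: beta_mix_fin].
Qed.

(** Convexity bounds every difference quotient at [x] towards [y] by the slope
    of the chord; the derivative is the limit of these quotients. *)
Lemma beta_tangent (x y : R) : (0 < x)%R -> (0 < y)%R ->
  (beta' beta r x * (y - x) <= fine (beta r y) - fine (beta r x))%R.
Proof.
move=> x0 y0; have [->|xy] := eqVneq y x; first by rewrite !subrr mulr0.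
have yx0 : (y - x != 0)%R by rewrite subr_eq0.
pose t n : R := n.+1%:R^-1%R.
have t0 n : (0 < t n)%R by rewrite invr_gt0.
pose u n := (t n * (y - x))%R.
have u0 n : u n != 0%R by rewrite mulf_neq0// gt_eqF.
have cu : u n @[n --> \oo] --> 0%R.
  by rewrite -(mul0r (y - x)%R); apply: cvgMr_tmp; exact: cvg_harmonic.
have cq := cvg_diff_quotient (ci_derivable hbeta (r := r) x0) u0 cu.
have cq' := cvgMr_tmp (b := (y - x)%R) cq.
have cc := cvg_cst (fine (beta r y) - fine (beta r x))%R (F := \oo).
apply: (ler_cvg_to (cq' _) (cc _)); near=> n; rewrite /=.
have t1 : (0 <= t n <= 1)%R.
  by rewrite (ltW (t0 n))/= invf_le1// ler1n.
have := fine_beta_convex (ltW y0) (ltW x0) t1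
  (ci_fin hbeta r y0) (ci_fin hbeta r x0).
have -> : (t n * y + (1 - t n) * x = u n + x)%R by rewrite /u; ring.
move=> h; rewrite /=; set A := (fine (beta r (u n + x)%R) - _)%R.
have -> : ((u n)^-1 * A * (y - x) = A / t n)%R.
  by rewrite /u; field; rewrite yx0 gt_eqF.
rewrite ler_pdivrMr// /A; move: h; set z := fine (beta r (u n + x)%R); lra.
Unshelve. all: by end_near. Qed.

Lemma beta'_le (x y : R) : (0 < x)%R -> (x <= y)%R ->
  (beta' beta r x <= beta' beta r y)%R.
Proof.
move=> x0; rewrite le_eqVlt => /orP[/eqP->//|xy].
have y0 := lt_trans x0 xy.
have h1 := beta_tangent x0 y0; have h2 := beta_tangent y0 x0.
rewrite -(ler_pM2r (_ : 0 < y - x)%R) ?subr_gt0//; lra.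
Qed.

Lemma beta'_le_pinfty (x : R) : (0 < x)%R ->
  (beta' beta r x)%:E <= beta'_pinfty beta r.
Proof.
move=> x0; pose g s := (beta' beta r (Num.max s x))%:E.
have g_homo : {homo g : s t / (s <= t)%R >-> s <= t}.
  move=> s t st; rewrite lee_fin; apply: beta'_le.
    by rewrite lt_max x0 orbT.
  by rewrite le_max2// lexx.
have cg := nondecreasing_cvge g_homo.
suff -> : beta'_pinfty beta r = ereal_sup (range g).
  by apply: ereal_sup_ubound; exists x => //; rewrite /g maxxx.
apply/cvg_lim => //; apply: cvg_trans cg; apply: near_eq_cvg.
near=> s; rewrite /g max_l//; near: s; exact: nbhs_pinfty_ge.
Unshelve. all: by end_near. Qed.

(** At the end of its domain the conjugate has an infinite left derivative:
    to the left of [tau] by [h], arguments up to [S] stay a fixed amount below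
    the supremum, and larger ones lose at least [S * h]. *)
Lemma conj_beta_steep (tau S : R) : (0 < S)%R ->
  conj_beta beta r tau \is a fin_num -> beta'_pinfty beta r <= tau%:E ->
  exists2 e, (0 < e)%R & forall h, (0 < h < e)%R ->
    (S * h <= fine (conj_beta beta r tau)
              - fine (conj_beta beta r (tau - h)%R))%R.
Proof.
move=> S0 fc taule; pose phi s : R := (s * tau - fine (beta r s))%R.
have phi_le s t : (0 < s)%R -> (s <= t)%R -> (phi s <= phi t)%R.
  move=> s0 st; have t0 := lt_le_trans s0 st.
  have := beta_tangent t0 s0.
  have : (beta' beta r t <= tau)%R.
    by rewrite -lee_fin (le_trans _ taule)// beta'_le_pinfty.
  rewrite -subr_ge0 => h1 h2; have : (0 <= (tau - beta' beta r t) * (t - s))%R.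
    by rewrite mulr_ge0// subr_ge0.
  rewrite /phi; lra.
have phi_conj s : (0 < s)%R -> (phi s <= fine (conj_beta beta r tau))%R.
  move=> s0; rewrite -lee_fin fineK//; have := young s tau.
  by rewrite -[beta r s in X in X -> _](fineK (ci_fin hbeta r s0)) -EFinB.
have S10 : (0 < S + 1)%R by rewrite addr_gt0.
have phi_lt : (phi S < phi (S + 1))%R.
  have ne : S != (S + 1)%R by rewrite -subr_eq0; apply/eqP; lra.
  have h2 : (0 < (2^-1 : R) < 1)%R by apply/andP; split; lra.
  have := ci_strictly_convex hbeta r S0 S10 ne h2.
  have m0 : (0 < 2^-1 * S + (1 - 2^-1) * (S + 1))%R by lra.
  rewrite -(fineK (ci_fin hbeta r m0)) -(fineK (ci_fin hbeta r S0)).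
  rewrite -(fineK (ci_fin hbeta r S10)) -!EFinM -EFinD lte_fin.
  have := @phi_le (2^-1 * S + (1 - 2^-1) * (S + 1))%R (S + 1)%R m0.
  rewrite /phi; set z := fine _; set z1 := fine _; set z2 := fine _ => h3 h4.
  by have := h3 ltac:(lra); lra.
pose eps := (fine (conj_beta beta r tau) - phi S)%R.
have eps0 : (0 < eps)%R by rewrite subr_gt0 (lt_le_trans phi_lt)// phi_conj.
exists (eps / S)%R; first by rewrite divr_gt0.
move=> h /andP[h0 he].
have Sh : (S * h < eps)%R by rewrite mulrC -ltr_pdivlMr.
have conj_le : conj_beta beta r (tau - h)%R <=
    (fine (conj_beta beta r tau) - S * h)%:E.
  rewrite conj_betaE; apply: ub_ereal_sup => _ [n _ <-]; rewrite lee_fin.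
  have := @posrat_gt0 R n; set q := posrat n => q0.
  have -> : (q * (tau - h) - 1 * fine (beta r q) = phi q - q * h)%R.
    by rewrite /phi; ring.
  have [qS|Sq] := leP q S.
    have := phi_le _ _ q0 qS; have : (0 <= q * h)%R by rewrite mulr_ge0// ltW.
    by move: Sh; rewrite /eps; lra.
  have := phi_conj _ q0; have : (S * h <= q * h)%R by rewrite ler_pM2r// ltW.
  lra.
have fc' : conj_beta beta r (tau - h)%R \is a fin_num.
  rewrite fin_numE gt_eqF ?conj_beta_gtNy//= lt_eqF//.
  by rewrite (le_lt_trans conj_le)// ltry.
by move: conj_le; rewrite -[X in X <= _](fineK fc') lee_fin; lra.
Qed.

(** Either the conjugate is differentiable at [tau], and then its derivative is
    the limit of the left difference quotients, or the derivative takes its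
    default value [0], which those nonnegative quotients dominate. *)
Lemma conj_beta'_le_quotients (tau : R) :
  conj_beta beta r tau \is a fin_num ->
  (conj_beta' beta r tau)%:E <= limn_einf (fun n => (n.+1%:R *
    (fine (conj_beta beta r tau)
     - fine (conj_beta beta r (tau - n.+1%:R^-1)%R)))%:E).
Proof.
move=> fc; rewrite /conj_beta'; set f := fine \o _.
pose u n : R := (- n.+1%:R^-1)%R.
pose Q n : R := (n.+1%:R * (f tau - f (tau - n.+1%:R^-1)))%R.
have QE n : Q n = ((u n)^-1 * (f (u n + tau) - f tau))%R.
  by rewrite /Q /u invrN invrK (addrC _ tau); ring.
have fin_left n : conj_beta beta r (tau - n.+1%:R^-1)%R \is a fin_num.
  rewrite fin_numE gt_eqF ?conj_beta_gtNy//= lt_eqF//.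
  apply: (@le_lt_trans _ _ (conj_beta beta r tau)).
    by apply: conj_beta_le; rewrite gerBl invr_ge0.
  by rewrite -(fineK fc) ltry.
have Q0 n : (0 <= Q n)%R.
  rewrite mulr_ge0// subr_ge0 -lee_fin /f /= !fineK//.
  by apply: conj_beta_le; rewrite gerBl invr_ge0.
have [df|ndf] := pselect (derivable f tau 1); last first.
  rewrite derive1E /derive dvgP//.
  apply: le_limn_einf; apply: nearW => n; rewrite lee_fin; exact: Q0.
have cQ : Q n @[n --> \oo] --> derive1 f tau.
  under eq_fun do rewrite QE; apply: cvg_diff_quotient => //.
    by move=> n; rewrite oppr_eq0 gt_eqF// invr_gt0.
  by rewrite -oppr0; apply: cvgN; exact: cvg_harmonic.
have ceQ : (Q n)%:E @[n --> \oo] --> (derive1 f tau)%:E.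
  by apply: cvg_EFin; [exact: nearW|exact: cQ].
by rewrite (cvg_limn_einf_sup ceQ).1.
Unshelve. all: by end_near. Qed.

End Integrand.

(** * Measurability and comparison of integrals *)

Section Integration.
Context {d : measure_display} {T : measurableType d} {R : realType}.
Variable mu : {measure set T -> \bar R}.
Import HBNNSimple.

(** Positive and negative parts are compared separately, which covers infinite
    integrals of either sign. *)
Lemma ae_le_integral_measurable (f g : T -> \bar R) :
  measurable_fun [set: T] f -> measurable_fun [set: T] g ->
  {ae mu, forall r, f r <= g r} -> \int[mu]_r f r <= \int[mu]_r g r.
Proof.
move=> mf mg fg; rewrite integralE [leRHS]integralE; apply: leeB.
  apply: ae_ge0_le_integral => //; try exact: measurable_funepos.
  apply: filterS fg => r fgr _; rewrite !funeposE.
  by rewrite ge_max le_max fgr/= le_max lexx orbT.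
apply: ae_ge0_le_integral => //; try exact: measurable_funeneg.
apply: filterS fg => r fgr _; rewrite !funenegE.
by rewrite ge_max le_max leeN2 fgr/= le_max lexx orbT.
Qed.

Lemma integrable_if (B : set T) (f g : T -> R) (M : R) :
  measurable B -> mu B < +oo -> measurable_fun [set: T] f ->
  (forall r, B r -> (`|f r| <= M)%R) -> mu.-integrable [set: T] (EFin \o g) ->
  mu.-integrable [set: T] (fun r => (if r \in B then f r else g r)%:E).
Proof.
move=> mB fB mf bf ig.
have -> : (fun r => (if r \in B then f r else g r)%:E) =
    (((EFin \o f) \_ B) \+ ((EFin \o g) \_ (~` B))).
  apply/funext => r; rewrite /patch in_setC.
  by case: (r \in B); rewrite /= ?adde0 ?add0e.
apply: integrableD => //.
  apply/(integrable_mkcond _ mB); apply: measurable_bounded_integrable => //.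
    exact: measurable_funTS.
  exists M; split; rewrite ?num_real// => x Mx r Br.
  exact: le_trans (bf r Br) (ltW Mx).
apply/(integrable_mkcond _ (measurableC mB)).
by apply: integrableS ig => //; exact: measurableC.
Qed.

Lemma measurable_ereal_sup_seq (f : nat -> T -> \bar R) :
  (forall n, measurable_fun [set: T] (f n)) ->
  measurable_fun [set: T] (fun r => ereal_sup (range (fun n => f n r))).
Proof.
move=> mf; have := measurable_fun_esups mf 0%N.
apply: eq_measurable_fun => r _; rewrite /esups /=; congr ereal_sup.
by apply/seteqP; split=> [_ [n _ <-]|_ [n _ <-]]; exists n.
Qed.

Lemma measurable_limn_einf (f : nat -> T -> \bar R) :
  (forall n, measurable_fun [set: T] (f n)) ->
  measurable_fun [set: T] (fun r => limn_einf (f ^~ r)).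
Proof.
move=> mf; rewrite /limn_einf; apply: measurableT_comp => //.
by apply: measurable_fun_limn_esup => n; exact: measurableT_comp.
Qed.

(** The integral of a possibly non-measurable [f], such as [p_theta], is a
    supremum over simple functions, each below [g] almost everywhere. *)
Lemma ae_le_integral_nonneg (f g : T -> \bar R) :
  measurable_fun [set: T] g -> (forall r, 0 <= g r) ->
  {ae mu, forall r, f r <= g r} -> \int[mu]_r f r <= \int[mu]_r g r.
Proof.
move=> mg g0 fg; rewrite integralE.
apply: (@le_trans _ _ (\int[mu]_r f^\+ r)).
  by rewrite -[leRHS]sube0; apply: leeB => //; apply: integral_ge0.
rewrite ge0_integralTE//; apply: ub_ereal_sup => _ [h /= hf <-].
rewrite -integralT_nnsfun; apply: ae_le_integral_measurable => //.
  exact/measurable_EFinP.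
apply: filterS fg => r fgr; apply: le_trans (hf r) _.
by rewrite funeposE ge_max fgr g0.
Qed.

End Integration.

Section MeasurableComposition.
Import HBNNSimple.
Context {d : measure_display} {T : measurableType d} {R : realType}.
Variable beta : T -> R -> \bar R.
Hypothesis hbeta : convex_integrand beta.

Lemma measurable_fun_beta_comp (p : T -> R) :
  measurable_fun [set: T] p -> (forall r, (0 <= p r)%R) ->
  measurable_fun [set: T] (fun r => beta r (p r)).
Proof.
move=> mp p0; have mp' : measurable_fun [set: T] (EFin \o p).
  exact/measurable_EFinP.
have [g [g_homo g_cvg]] := approximation measurableT mp' (fun r _ => p0 r).
(* Adding [1 / n] approaches the points where [p] vanishes from the right. *)
pose e n : R := n.+1%:R^-1%R.
have e0 n : (0 < e n)%R by rewrite invr_gt0.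
refine (emeasurable_fun_cvg (fun n r => beta r (g n r + e n)%R)
  (fun r => beta r (p r)) _ _).
  move=> n _ B mB; rewrite setTI.
  have -> : (fun r => beta r (g n r + e n)%R) @^-1` B =
      \bigcup_(y in range (g n)) (g n @^-1` [set y] `&`
        (beta ^~ (y + e n)%R) @^-1` B).
    apply/seteqP; split=> [r Br|r [_ [s _ <-] [/= -> //]]].
    by exists (g n r) => //; exists r.
  apply: fin_bigcup_measurable => [|y _]; first exact: fimfunP.
  apply: measurableI => //.
  by rewrite -[X in measurable X]setTI; exact: (ci_measurable hbeta).
move=> r _.
have cg : g n r @[n --> \oo] --> p r by apply: fine_cvg (g_cvg r I).
have [pr0|pr0] := eqVneq (p r) 0%R.
  have gr0 n : g n r = 0%R.
    apply/eqP; rewrite eq_le; apply/andP; split=> //.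
    rewrite -pr0 -(cvg_lim _ cg)//; apply: nondecreasing_cvgn_le.
      by move=> m k mk; have /lefP := g_homo _ _ mk; exact.
    by apply/cvg_ex; exists (p r).
  rewrite pr0; under eq_fun do rewrite gr0.
  exact: cvg_comp (@cvg_shift_harmonic R 0%R)
    (beta_cvg_right (r := r) hbeta (lexx _)).
have pr1 : (0 < p r)%R by rewrite lt_neqAle eq_sym pr0 p0.
have cge : (g n r + e n)%R @[n --> \oo] --> p r.
  by rewrite -[p r]addr0; apply: cvgD => //; exact: cvg_harmonic.
exact: cvg_comp cge (beta_cvg (r := r) hbeta pr1).
Qed.

End MeasurableComposition.

(** * Interchange of supremum and integral *)

Section Admissible.
Context {d : measure_display} {T : measurableType d} {R : realType}.
Variable mu : {sigma_finite_measure set T -> \bar R}.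
Variables (beta : T -> R -> \bar R) (X : T -> R).

(** Nonnegative functions, of arbitrary mass, for which every integral of the
    problem is a finite number. *)
Record admissible (p : T -> R) : Prop := Admissible {
  adm_measurable : measurable_fun [set: T] p ;
  adm_ge0 : forall r, (0 <= p r)%R ;
  adm_fin : forall r, beta r (p r) \is a fin_num ;
  adm_mass : mu.-integrable [set: T] (EFin \o p) ;
  adm_moment : mu.-integrable [set: T] (fun r => (X r * p r)%:E) ;
  adm_cost : mu.-integrable [set: T] (fun r => (fine (beta r (p r)))%:E) }.

Definition mass (p : T -> R) : R := (\int[mu]_r p r)%R.
Definition moment (p : T -> R) : R := (\int[mu]_r (X r * p r))%R.
Definition cost (p : T -> R) : R := (\int[mu]_r fine (beta r (p r)))%R.

Definition integrand (a c l : R) (r : T) (s : R) : R :=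
  (s * (a + c * X r) - l * fine (beta r s))%R.

Definition lagrangian (a c l : R) (p : T -> R) : R :=
  (a * mass p + c * moment p - l * cost p)%R.

Lemma integrand_split a c l p : (fun r => (integrand a c l r (p r))%:E) =
  ((fun r => a%:E * (p r)%:E) \+ (fun r => c%:E * (X r * p r)%:E))
    \+ (fun r => (- l)%:E * (fine (beta r (p r)))%:E).
Proof.
by apply/funext => r /=; rewrite -!EFinM -!EFinD /integrand; congr EFin; ring.
Qed.

Lemma integrable_integrand a c l p : admissible p ->
  mu.-integrable [set: T] (fun r => (integrand a c l r (p r))%:E).
Proof.
move=> [_ _ _ ip iX ib]; rewrite integrand_split.
apply: integrableD => //; last exact: integrableZl.
by apply: integrableD => //; exact: integrableZl.
Qed.

Lemma integral_integrand a c l p : admissible p ->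
  \int[mu]_r (integrand a c l r (p r))%:E = (lagrangian a c l p)%:E.
Proof.
move=> [_ _ _ ip iX ib]; rewrite integrand_split.
have i1 := integrableZl measurableT a ip.
have i2 := integrableZl measurableT c iX.
have i3 := integrableZl measurableT (- l)%R ib.
rewrite (integralD _ _ i3)//; last exact: integrableD.
rewrite (integralD _ i1 i2)// !integralZl//.
rewrite /lagrangian /mass /moment /cost /Rintegral.
rewrite !EFinB EFinD !EFinM !fineK; try exact: integrable_fin_num.
by rewrite EFinN mulNe.
Qed.

Hypotheses (hbeta : convex_integrand beta) (hX : measurable_fun [set: T] X).

Lemma measurable_fine_beta s :
  measurable_fun [set: T] (fun r => fine (beta r s)).
Proof.
by apply: measurableT_comp => //; exact: (ci_measurable hbeta).
Qed.

Lemma admissible_swap p q N (B : set T) : admissible p -> (0 < q)%R ->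
  measurable B -> mu B < +oo ->
  (forall r, B r -> (`|X r| <= N)%R /\ (`|fine (beta r q)| <= N)%R) ->
  admissible (fun r => if r \in B then q else p r).
Proof.
move=> [mp p0 fp ip iX ib] q0 mB fB hB.
split.
- apply: measurable_fun_ifT => //.
  apply: (measurable_fun_bool true); rewrite setTI.
  rewrite [X in measurable X](_ : _ = B)//.
  by apply/seteqP; split=> r /=; [exact: set_mem|exact: mem_set].
- by move=> r; case: ifP => _; [exact: ltW|].
- by move=> r; case: ifP => _; [exact: (ci_fin hbeta)|].
- by apply: (@integrable_if _ _ _ _ _ (cst q) p `|q|%R).
- rewrite [X in _.-integrable _ X](_ : _ =
      fun r => (if r \in B then (X r * q)%R else (X r * p r)%R)%:E); last first.
    by apply/funext => r; case: ifP.
  apply: (@integrable_if _ _ _ _ _ (fun r => X r * q)%R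
    (fun r => X r * p r)%R (N * q)%R) => //.
    by apply: measurable_funM.
  move=> r Br; rewrite normrM (gtr0_norm q0) ler_pM2r//.
  exact: (hB r Br).1.
- rewrite [X in _.-integrable _ X](_ : _ = fun r =>
      (if r \in B then fine (beta r q) else fine (beta r (p r)))%:E); last first.
    by apply/funext => r; case: ifP.
  apply: (@integrable_if _ _ _ _ _ (fun r => fine (beta r q))
    (fun r => fine (beta r (p r))) N) => //.
    exact: measurable_fine_beta.
  by move=> r Br; exact: (hB r Br).2.
Qed.

Lemma measurable_integrand a c l s :
  measurable_fun [set: T] (fun r => integrand a c l r s).
Proof.
apply: measurable_funB; last first.
  by apply: measurable_funM => //; exact: measurable_fine_beta.
apply: measurable_funM => //; apply: measurable_funD => //.
exact: measurable_funM.
Qed.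

Section Interchange.
Variables (a c l : R) (p0 : T -> R) (hp0 : admissible p0).
Variable (Omega : nat -> set T).
Hypothesis mOmega : forall n, measurable (Omega n).
Hypothesis fOmega : forall n, mu (Omega n) < +oo.

Let phi := integrand a c l.

Definition tame (N i : nat) : set T :=
  [set r | [/\ Omega N r, (`|X r| <= N%:R)%R &
               (`|fine (beta r (posrat i))| <= N%:R)%R]].

(** Among [p0] and the first [i] positive rationals, the value maximising the
    integrand, where a rational competes only on a set of finite measure on
    which nothing is unbounded. *)
Fixpoint selector (N i : nat) : T -> R :=
  if i is j.+1 then
    fun r => if r \in (tame N j `&`
                       [set r | phi r (selector N j r) < phi r (posrat j)]%R)
             then posrat j else selector N j r
  else p0.

Lemma measurable_tame N i : measurable (tame N i).
Proof.
rewrite (_ : tame N i = Omega N `&`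
    ((fun r => `|X r|%R) @^-1` `]-oo, N%:R] `&`
     (fun r => `|fine (beta r (posrat i))|%R) @^-1` `]-oo, N%:R])); last first.
  apply/seteqP; split=> r; rewrite /tame /= !in_itv /=.
    by move=> [? ? ?].
  by move=> [? [? ?]].
apply: measurableI => //; apply: measurableI; rewrite -[X in measurable X]setTI.
  by apply: measurableT_comp => //.
apply: measurableT_comp => //; exact: measurable_fine_beta.
Qed.

Lemma selector_admissible N i : admissible (selector N i).
Proof.
elim: i => [|i IH]//=; set B := _ `&` _.
have mB : measurable B.
  apply: measurableI; first exact: measurable_tame.
  have mi : measurable_fun [set: T] (fun r => phi r (selector N i r)).
    have := measurable_int _ (integrable_integrand a c l IH).
    by move/measurable_EFinP.
  have := measurable_fun_ltr mi (measurable_integrand a c l (posrat i)).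
  by move=> /(_ measurableT [set true] I); rewrite setTI.
apply: (@admissible_swap _ _ N%:R) => //.
- exact: posrat_gt0.
- apply: le_lt_trans (fOmega N); apply: le_measure; rewrite ?inE//.
  by move=> r [[]].
- by move=> r [[]].
Qed.

Lemma selector_ge N i r : (phi r (p0 r) <= phi r (selector N i r))%R /\
  forall j, (j < i)%N -> tame N j r ->
    (phi r (posrat j) <= phi r (selector N i r))%R.
Proof.
elim: i => [|i [IH0 IH]]//=.
case: ifPn => [|].
  rewrite inE => -[_ /= lt]; split; first exact: le_trans IH0 (ltW lt).
  move=> j; rewrite ltnS leq_eqVlt => /orP[/eqP->//|ji tj].
  exact: le_trans (IH _ ji tj) (ltW lt).
rewrite notin_setE => nt; split=> // j; rewrite ltnS leq_eqVlt.
move=> /orP[/eqP-> ti|].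
  by rewrite leNgt; apply/negP => lt; apply: nt.
exact: IH.
Qed.

End Interchange.

(** The supremum over admissible functions may be taken under the integral
    sign: the selectors are admissible and increase the integrand to its
    pointwise supremum. *)
Lemma integral_sup_le (a c l C : R) :
  (exists p, admissible p) ->
  (forall p, admissible p -> (lagrangian a c l p <= C)%R) ->
  \int[mu]_r ereal_sup (range (fun n => (integrand a c l r (posrat n))%:E))
    <= C%:E.
Proof.
move=> [p0 hp0] hC.
have [Om [OmT Om_homo mOm]] := (sigma_finiteP _ _).1 (sigma_finiteT mu).
have mOm1 n := (mOm n).1; have mOm2 n := (mOm n).2.
pose phi := integrand a c l.
pose S r := ereal_sup (range (fun n => (phi r (posrat n))%:E)).
pose P N := selector a c l p0 Om N N.
have admP N : admissible (P N) by exact: selector_admissible.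
pose f N r := (phi r (P N r))%:E - (phi r (p0 r))%:E.
have i0 := integrable_integrand a c l hp0.
have iP N := integrable_integrand a c l (admP N).
have f0 N r : 0 <= f N r.
  rewrite /f -EFinB lee_fin subr_ge0.
  by have [] := selector_ge a c l p0 Om N N r.
have intf N : \int[mu]_r f N r <= C%:E - (lagrangian a c l p0)%:E.
  rewrite integralB//; rewrite !integral_integrand//.
  by rewrite -!EFinB lee_fin lerD2r hC.
have mS : measurable_fun [set: T] S.
  apply: measurable_ereal_sup_seq => n; apply/measurable_EFinP.
  exact: measurable_integrand.
have S_ge r : (phi r (p0 r))%:E <= S r.
  by apply: (le_sup_posrat hbeta); [exact: adm_ge0 hp0 r|exact: adm_fin hp0 r].
have m0 : measurable_fun [set: T] (fun r => (phi r (p0 r))%:E).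
  exact: measurable_int i0.
have le_liminf r : S r - (phi r (p0 r))%:E <= limn_einf (f ^~ r).
  rewrite leeBlDr//; apply: ub_ereal_sup => _ [n _ <-].
  rewrite -leeBlDr//; apply: le_limn_einf.
  have [m Om_m] : exists m, Om m r.
    by have : [set: T] r by []; rewrite OmT => -[m _ ?]; exists m.
  near=> N; rewrite /f -!EFinB lee_fin lerD2r.
  have [_] := selector_ge a c l p0 Om N N r; apply.
    by near: N; exact: nbhs_infty_gt.
  split.
  - have mN : (m <= N)%N by near: N; exact: nbhs_infty_ge.
    by have /subsetPset := Om_homo _ _ mN; exact.
  - by near: N; exact: nbhs_infty_ger.
  - by near: N; exact: nbhs_infty_ger.
have mf N : measurable_fun [set: T] (f N).
  by apply: emeasurable_funB => //; exact: measurable_int (iP N).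
have gap0 r : 0 <= S r - (phi r (p0 r))%:E by rewrite sube_ge0.
have mgap : measurable_fun [set: T] (fun r => S r - (phi r (p0 r))%:E).
  exact: emeasurable_funB.
have gap : \int[mu]_r (S r - (phi r (p0 r))%:E) <=
    C%:E - (lagrangian a c l p0)%:E.
  apply: (@le_trans _ _ (\int[mu]_r limn_einf (f ^~ r))).
    apply: ae_le_integral_measurable => //; first exact: measurable_limn_einf.
    exact: nearW.
  apply: le_trans (fatou mu measurableT mf (fun n r _ => f0 n r)) _.
  rewrite limn_einf_lim; apply: lime_le; first exact: is_cvg_einfs.
  near=> n; apply: le_trans (intf n); apply: ereal_inf_lbound.
  by exists n => /=.
have igap : mu.-integrable [set: T] (fun r => S r - (phi r (p0 r))%:E).
  apply/integrableP; split=> //.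
  under eq_integral do rewrite gee0_abs//.
  by apply: le_lt_trans gap _; rewrite -EFinB ltry.
have -> : \int[mu]_r S r =
    \int[mu]_r ((S r - (phi r (p0 r))%:E) + (phi r (p0 r))%:E).
  by apply: eq_integral => r _; rewrite subeK.
rewrite integralD// integral_integrand//.
by rewrite -leeBrDr.
Unshelve. all: by end_near. Qed.

End Admissible.

(** * Lagrange multipliers *)

Section Duality.
Context {R : realType} {E : Type}.

(** Lagrange duality for a single affine constraint: the quotients [f / - g]
    on the side [g < 0] dominate those on the side [0 < g], since a violation
    could be mixed into a point with [g = 0] and [f < 0]; any number in
    between is a multiplier. *)
Lemma lagrange_multiplier (D : set E) (f g : E -> R) :
  (forall p q t, D p -> D q -> (0 <= t <= 1)%R -> exists m,
    [/\ D m, g m = (t * g p + (1 - t) * g q)%R &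
        (f m <= t * f p + (1 - t) * f q)%R]) ->
  (exists2 p, D p & (g p < 0)%R) -> (exists2 p, D p & (0 < g p)%R) ->
  (forall p, D p -> g p = 0%R -> (0 <= f p)%R) ->
  exists lam : R, forall p, D p -> (0 <= f p + lam * g p)%R.
Proof.
move=> mix [p1 Dp1 gp1] [q1 Dq1 gq1] f0.
pose A := [set (- f q / g q)%R | q in [set q | D q /\ (0 < g q)%R]].
have cross p q : D p -> D q -> (g p < 0)%R -> (0 < g q)%R ->
    (- f q / g q <= f p / - g p)%R.
  move=> Dp Dq gp gq; pose t := (g q / (g q - g p))%R.
  have gg : (0 < g q - g p)%R by rewrite subr_gt0 (lt_trans gp).
  have t01 : (0 <= t <= 1)%R.
    apply/andP; split; first by rewrite divr_ge0 ?ltW.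
    by rewrite ler_pdivrMr// mul1r lerDl oppr_ge0 ltW.
  have [m [Dm gm fm]] := mix _ _ _ Dp Dq t01.
  have gm0 : g m = 0%R by rewrite gm /t; field; rewrite gt_eqF.
  have := le_trans (f0 _ Dm gm0) fm.
  have -> : (t * f p + (1 - t) * f q = (g q * f p - g p * f q) / (g q - g p))%R.
    by rewrite /t; field; rewrite gt_eqF.
  rewrite ler_pdivlMr// mul0r => h.
  rewrite ler_pdivrMr// mulrAC ler_pdivlMr ?oppr_gt0//; lra.
have supA : has_sup A.
  split; first by exists (- f q1 / g q1)%R, q1.
  by exists (f p1 / - g p1)%R => _ [q [Dq gq] <-]; exact: cross.
exists (sup A) => p Dp; have [gp|gp|gp] := ltgtP (g p) 0%R.
- have : (sup A <= f p / - g p)%R.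
    by apply: ge_sup; [exact: supA.1|move=> _ [q [Dq gq] <-]; exact: cross].
  by rewrite ler_pdivlMr ?oppr_gt0//; lra.
- have : (- f p / g p <= sup A)%R by apply: ub_le_sup; [exact: supA.2|exists p].
  by rewrite ler_pdivrMr//; lra.
- by rewrite gp mulr0 addr0; exact: f0.
Qed.

End Duality.

Section SupPosrat.
Context {R : realType}.

Lemma sup_posrat_ge0 (w : R) :
  0 <= ereal_sup (range (fun n => (posrat n * w)%:E)).
Proof.
apply/lee_addgt0Pr => e e0.
have w1 : (0 < `|w| + 1)%R by rewrite ltr_wpDl.
have [n /andP[n0 nlt]] := posrat_dense (lexx 0%R) (divr_gt0 e0 w1).
have : (posrat n * w)%:E <= ereal_sup (range (fun n => (posrat n * w)%:E)).
  by apply: ereal_sup_ubound; exists n.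
rewrite -(leeD2rE _ _ (_ : e%:E \is a fin_num))//; apply: le_trans.
rewrite -EFinD lee_fin; move: nlt; rewrite ltr_pdivlMr// => nlt.
have : (- (posrat n * w) <= posrat n * (`|w| + 1))%R.
  by rewrite -mulrN ler_pM2l// (le_trans (ler_norm _))// normrN lerDl.
lra.
Qed.

Lemma sup_posrat_pinfty (w : R) : (0 < w)%R ->
  ereal_sup (range (fun n => (posrat n * w)%:E)) = +oo.
Proof.
move=> w0; apply/eqyP => A A0.
have [||n /andP[nA _]] := @posrat_dense _ (A / w)%R (A / w + 1)%R.
- by rewrite divr_ge0// ltW.
- by rewrite ltrDl.
apply: (@le_trans _ _ (posrat n * w)%:E).
  by rewrite lee_fin -ler_pdivrMr// ltW.
by apply: ereal_sup_ubound; exists n.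
Qed.

End SupPosrat.

(** * Densities and admissible functions *)

Section Model.
Context {d : measure_display} {T : measurableType d} {R : realType}.
Variable mu : {sigma_finite_measure set T -> \bar R}.
Variables (beta : T -> R -> \bar R) (X : T -> R).
Hypotheses (hbeta : convex_integrand beta) (hX : measurable_fun [set: T] X).
Hypothesis H_ge0 : forall p, density mu p -> 0 <= H mu beta p.

Implicit Types p q : T -> R.

Local Notation admissible := (admissible mu beta X).
Local Notation mass := (mass mu).
Local Notation moment := (moment mu X).
Local Notation cost := (cost mu beta).
Local Notation lagrangian := (lagrangian mu beta X).
Local Notation integrand := (integrand beta X).

Lemma integral_exists_integrable (f : T -> \bar R) :
  mu.-integrable [set: T] f -> integral_exists mu f.
Proof. by move=> fi; left; exact: integral_funepos_lt_pinfty. Qed.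

Lemma upper_integral_integrable (f : T -> \bar R) :
  mu.-integrable [set: T] f -> upper_integral mu f = \int[mu]_r f r.
Proof.
by move=> /integral_exists_integrable fi; rewrite /upper_integral asboolT.
Qed.

(** A finite integral could also come from the convention on infinite parts,
    unless one of the two parts is finite. *)
Lemma integrable_of_integral (f : T -> \bar R) : measurable_fun [set: T] f ->
  integral_exists mu f -> \int[mu]_r f r \is a fin_num ->
  mu.-integrable [set: T] f.
Proof.
move=> mf; rewrite integralE /integral_exists.
have pos_ge0 : 0 <= \int[mu]_r f^\+ r by apply: integral_ge0.
have neg_ge0 : 0 <= \int[mu]_r f^\- r by apply: integral_ge0.
move=> ex fi; apply/integrableP; split=> //.
rewrite -/(abse \o f) fune_abse ge0_integralD//; last 2 first.
- exact: measurable_funepos.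
- exact: measurable_funeneg.
move: ex fi pos_ge0 neg_ge0.
case: (\int[mu]_r f^\+ r) => [x| |]; case: (\int[mu]_r f^\- r) => [y| |] //=.
all: by rewrite ?ltry//; case.
Qed.

Lemma density_integrable p : density mu p -> H mu beta p < +oo ->
  mu.-integrable [set: T] (fun r => beta r (p r)).
Proof.
move=> dp; have := H_ge0 dp; have [mp p0 _] := dp.
rewrite /H /upper_integral.
case: ifPn => [/asboolP ex h0 hy|_]; last by rewrite ltxx.
apply: integrable_of_integral => //; first exact: measurable_fun_beta_comp.
by rewrite fin_numE gt_eqF ?lt_eqF//= (lt_le_trans _ h0).
Qed.

(** On the null set where the cost is infinite the value is changed to [1], at
    which the integrand is finite. *)
Lemma admissible_version (p : T -> R) : measurable_fun [set: T] p ->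
  (forall r, (0 <= p r)%R) -> mu.-integrable [set: T] (EFin \o p) ->
  mu.-integrable [set: T] (fun r => beta r (p r)) ->
  exists2 p' : T -> R, [/\ measurable_fun [set: T] p',
    (forall r, (0 <= p' r)%R) & (forall r, beta r (p' r) \is a fin_num)] &
    {ae mu, forall r, p' r = p r}.
Proof.
move=> mp p0 ip ib.
exists (fun r => if beta r (p r) \is a fin_num then p r else 1%R); last first.
  by apply: filterS (integrable_ae measurableT ib) => r /(_ I) ->.
split=> [|r|r].
- apply: measurable_fun_ifT => //; apply: (measurable_fun_bool true).
  exact: emeasurable_fin_num (measurable_int _ ib).
- by case: ifP.
- by case: ifP => // _; exact: (ci_fin hbeta).
Qed.

Lemma ae_eq_integrable (f g : T -> \bar R) : measurable_fun [set: T] f ->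
  {ae mu, forall r, f r = g r} -> mu.-integrable [set: T] g ->
  mu.-integrable [set: T] f.
Proof.
move=> mf fg /integrableP[mg ig]; apply/integrableP; split=> //.
rewrite (ae_eq_integral (abse \o g))//; try exact: measurableT_comp.
by apply: filterS fg => r -> _.
Qed.

Lemma density_admissible p : density mu p -> H mu beta p < +oo ->
  mu.-integrable [set: T] (fun r => (X r * p r)%:E) ->
  exists p', [/\ admissible p', mass p' = 1%R,
    (moment p')%:E = \int[mu]_r (X r * p r)%:E & (cost p')%:E = H mu beta p].
Proof.
move=> dp Hp iX; have ib := density_integrable dp Hp.
have [mp p0 p1] := dp.
have ip : mu.-integrable [set: T] (EFin \o p).
  apply/integrableP; split; first exact/measurable_EFinP.
  under eq_integral do rewrite gee0_abs ?lee_fin//=.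
  by rewrite p1 ltry.
have [p' [mp' p'0 fp'] p'p] := admissible_version mp p0 ip ib.
have mb : measurable_fun [set: T] (fun r => (fine (beta r (p' r)))%:E).
  apply/measurable_EFinP; apply: measurableT_comp => //.
  exact: measurable_fun_beta_comp.
have e1 : {ae mu, forall r, (p' r)%:E = (p r)%:E} by apply: filterS p'p => r ->.
have e2 : {ae mu, forall r, (X r * p' r)%:E = (X r * p r)%:E}.
  by apply: filterS p'p => r ->.
have e3 : {ae mu, forall r, (fine (beta r (p' r)))%:E = beta r (p r)}.
  by apply: filterS p'p => r <-; rewrite fineK.
have m2 : measurable_fun [set: T] (fun r => (X r * p' r)%:E).
  by apply/measurable_EFinP; exact: measurable_funM.
have m1 : measurable_fun [set: T] (EFin \o p') by exact/measurable_EFinP.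
have ap' : admissible p'.
  split=> //.
  - exact: ae_eq_integrable ip.
  - exact: ae_eq_integrable iX.
  - exact: ae_eq_integrable ib.
have [_ _ _ ip' iX' ib'] := ap'.
exists p'; split=> //.
- rewrite /mass /Rintegral (ae_eq_integral (EFin \o p))//.
  + by rewrite p1.
  + exact: measurable_int ip.
  + by apply: filterS e1 => r.
- rewrite /moment /Rintegral fineK; last exact: integrable_fin_num.
  apply: ae_eq_integral => //; first exact: measurable_int iX.
  by apply: filterS e2 => r.
- rewrite /cost /Rintegral fineK; last exact: integrable_fin_num.
  rewrite /H upper_integral_integrable//.
  apply: ae_eq_integral => //; first exact: measurable_int ib.
  by apply: filterS e3 => r.
Qed.

Lemma admissible_density p : admissible p -> mass p = 1%R ->
  density mu p /\ \int[mu]_r (X r * p r)%:E = (moment p)%:E /\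
  H mu beta p = (cost p)%:E.
Proof.
move=> [mp p0 fp ip iX ib] p1; split; first split=> //.
  by rewrite -p1 /mass /Rintegral fineK//; exact: integrable_fin_num.
split; first by rewrite /moment /Rintegral fineK//; exact: integrable_fin_num.
have -> : H mu beta p = upper_integral mu (fun r => (fine (beta r (p r)))%:E).
  by rewrite /H; congr upper_integral; apply/funext => r; rewrite fineK.
rewrite upper_integral_integrable// /cost /Rintegral fineK//.
exact: integrable_fin_num.
Qed.

Lemma integrable_between (f g h : T -> R) : measurable_fun [set: T] f ->
  (forall r, (h r <= f r <= g r)%R) -> mu.-integrable [set: T] (EFin \o h) ->
  mu.-integrable [set: T] (EFin \o g) -> mu.-integrable [set: T] (EFin \o f).
Proof.
move=> mf hfg ih ig; apply: (@le_integrable _ _ _ _ _ _ _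
  ((EFin \o (fun r => `|h r|%R)) \+ (EFin \o (fun r => `|g r|%R)))) => //.
- exact/measurable_EFinP.
- move=> r _ /=; rewrite lee_fin [leRHS]ger0_norm ?addr_ge0//.
  have /andP[h1 h2] := hfg r; rewrite ler_norml.
  have := ler_norm (g r); have := ler_norm (- h r)%R; rewrite normrN.
  have := normr_ge0 (g r); have := normr_ge0 (h r).
  by move=> *; apply/andP; split; lra.
- by apply: integrableD => //; exact: integrable_norm.
Qed.

Lemma affine_mix_integrable (t : R) (f g : T -> R) :
  mu.-integrable [set: T] (EFin \o f) -> mu.-integrable [set: T] (EFin \o g) ->
  mu.-integrable [set: T] (EFin \o (fun r => t * f r + (1 - t) * g r)%R).
Proof.
move=> fi gi; have -> : EFin \o (fun r => t * f r + (1 - t) * g r)%R =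
    ((fun r => t%:E * (f r)%:E) \+ (fun r => (1 - t)%:E * (g r)%:E)).
  by apply/funext => r /=; rewrite EFinD !EFinM.
by apply: integrableD => //; exact: integrableZl.
Qed.

Lemma Rintegral_mix (t : R) (f g : T -> R) :
  mu.-integrable [set: T] (EFin \o f) -> mu.-integrable [set: T] (EFin \o g) ->
  (\int[mu]_r (t * f r + (1 - t) * g r)
   = t * \int[mu]_r f r + (1 - t) * \int[mu]_r g r)%R.
Proof.
move=> fi gi; rewrite RintegralD// ?RintegralZl//.
  exact: (integrableZl measurableT t fi).
exact: (integrableZl measurableT (1 - t)%R gi).
Qed.

(** * Convexity of the problem and existence of multipliers *)

Section ReferenceDensity.
Variable p0 : T -> R.
Hypotheses (adm0 : admissible p0) (mass0 : mass p0 = 1%R).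

(** Otherwise the mass would be at least [1 > 0] throughout, while the
    pointwise infimum of [s] over the positive rationals is [0]. *)
Lemma mass_lt1 : exists2 p, admissible p & (mass p < 1)%R.
Proof.
apply: contrapT => hn.
have h p : admissible p -> (lagrangian (-1) 0 0 p <= -1)%R.
  move=> ap; have : (1 <= mass p)%R.
    by rewrite leNgt; apply/negP => lt; apply: hn; exists p.
  rewrite /lagrangian; lra.
have := integral_sup_le hbeta hX (ex_intro _ p0 adm0) h.
rewrite leNgt => /negP; apply; apply: (@lt_le_trans _ _ 0%E).
  by rewrite lte_fin ltrN10.
apply: integral_ge0 => r _; under eq_fun do rewrite /integrand !mul0r subr0.
exact: sup_posrat_ge0.
Qed.

Lemma mass_gt1 : exists2 p, admissible p & (1 < mass p)%R.
Proof.
apply: contrapT => hn.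
have h p : admissible p -> (lagrangian 1 0 0 p <= 1)%R.
  move=> ap; have : (mass p <= 1)%R.
    by rewrite leNgt; apply/negP => lt; apply: hn; exists p.
  rewrite /lagrangian; lra.
have := integral_sup_le hbeta hX (ex_intro _ p0 adm0) h.
rewrite leNgt => /negP; apply.
under eq_integral => r _.
  under eq_fun do rewrite /integrand !mul0r subr0 addr0.
  rewrite sup_posrat_pinfty//; over.
apply: (@lt_le_trans _ _ (\int[mu]_r (2 * p0 r)%:E)).
  under eq_integral do rewrite EFinM.
  rewrite integralZl//; last exact: adm_mass adm0.
  move: mass0; rewrite /mass /Rintegral => m0.
  rewrite -(fineK (integrable_fin_num measurableT (adm_mass adm0))) m0.
  by rewrite -EFinM lte_fin; lra.
apply: ae_le_integral_measurable => //.
  apply/measurable_EFinP; apply: measurable_funM => //.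
  exact: adm_measurable adm0.
by apply: nearW => r; rewrite leey.
Qed.

(** An upper bound on the cost integrand suffices for admissibility. For a
    density the negative part is controlled by [H_ge0]; any other mass is
    first mixed to mass one, and convexity transfers the lower bound. *)
Lemma admissible_of_le p (g : T -> R) : measurable_fun [set: T] p ->
  (forall r, (0 <= p r)%R) -> (forall r, beta r (p r) \is a fin_num) ->
  mu.-integrable [set: T] (EFin \o p) ->
  mu.-integrable [set: T] (fun r => (X r * p r)%:E) ->
  mu.-integrable [set: T] (EFin \o g) ->
  (forall r, (fine (beta r (p r)) <= g r)%R) -> admissible p.
Proof.
have unit_mass q (f : T -> R) : measurable_fun [set: T] q ->
    (forall r, (0 <= q r)%R) -> (forall r, beta r (q r) \is a fin_num) ->
    mu.-integrable [set: T] (EFin \o q) ->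
    mu.-integrable [set: T] (fun r => (X r * q r)%:E) ->
    mu.-integrable [set: T] (EFin \o f) ->
    (forall r, (fine (beta r (q r)) <= f r)%R) -> mass q = 1%R -> admissible q.
  move=> mq q0 fq iq iXq if_ qf q1.
  have dq : density mu q.
    split=> //; rewrite -q1 /mass /Rintegral fineK//.
    exact: integrable_fin_num.
  have mb := measurable_fun_beta_comp hbeta mq q0.
  have pos : \int[mu]_r (fun r => beta r (q r))^\+ r < +oo.
    apply: le_lt_trans (integral_funepos_lt_pinfty measurableT if_).
    apply: ae_le_integral_measurable; try exact: measurable_funepos.
      by apply: measurable_funepos; exact: measurable_int if_.
    apply: nearW => r; rewrite !funeposE ge_max !le_max lexx orbT andbT.
    by rewrite -(fineK (fq r)) lee_fin qf.
  have Hq : H mu beta q < +oo.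
    rewrite /H /upper_integral asboolT; last by left.
    rewrite integralE; apply: le_lt_trans pos.
    by rewrite -[leRHS]sube0; apply: leeB => //; apply: integral_ge0.
  split=> //; under eq_fun do rewrite fineK//.
  exact: density_integrable.
move=> mp p_ge0 fp ip iXp ig pg.
have [p1|np1] := eqVneq (mass p) 1%R; first exact: (unit_mass p g).
have [q aq [t /andP[t0 t1] tE]] : exists2 q, admissible q &
    exists2 t : R, (0 < t < 1)%R & (t * mass p + (1 - t) * mass q = 1)%R.
  have [lt|gt|eq] := ltgtP (mass p) 1%R; last by rewrite eq eqxx in np1.
    have [q aq q1] := mass_gt1; exists q => //.
    have mm : (0 < mass q - mass p)%R by rewrite subr_gt0 (lt_trans lt).
    exists ((mass q - 1) / (mass q - mass p))%R.
      apply/andP; split; first by rewrite divr_gt0// subr_gt0.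
      by rewrite ltr_pdivrMr//; lra.
    by field; rewrite gt_eqF.
  have [q aq q1] := mass_lt1; exists q => //.
  have mm : (0 < mass p - mass q)%R by rewrite subr_gt0 (lt_trans q1).
  exists ((1 - mass q) / (mass p - mass q))%R.
    apply/andP; split; first by rewrite divr_gt0// subr_gt0.
    by rewrite ltr_pdivrMr//; lra.
  by field; rewrite gt_eqF.
have [mq q0 fq iq iXq ibq] := aq.
have t01 : (0 <= t <= 1)%R by rewrite !ltW.
pose m r := (t * p r + (1 - t) * q r)%R.
have m0 r : (0 <= m r)%R.
  by apply: addr_ge0; rewrite mulr_ge0// ?subr_ge0 ltW.
have fm r : beta r (m r) \is a fin_num by exact: beta_mix_fin.
have bm r : (fine (beta r (m r)) <=
    t * fine (beta r (p r)) + (1 - t) * fine (beta r (q r)))%R.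
  exact: fine_beta_convex.
have mm : measurable_fun [set: T] m.
  by apply: measurable_funD; apply: measurable_funM.
have im : mu.-integrable [set: T] (EFin \o m) by exact: affine_mix_integrable.
have iXm : mu.-integrable [set: T] (fun r => (X r * m r)%:E).
  have := affine_mix_integrable t iXp iXq.
  by apply: eq_integrable => // r _ /=; congr EFin; rewrite /m; ring.
have am : admissible m.
  apply: (unit_mass m
    (fun r => t * g r + (1 - t) * fine (beta r (q r)))%R) => //.
  - exact: affine_mix_integrable.
  - move=> r; apply: le_trans (bm r) _.
    by rewrite lerD2r ler_pM2l.
  - by rewrite -tE /mass -Rintegral_mix.
split=> //; have t1' : (t != 0)%R by rewrite gt_eqF.
apply: (@integrable_between _ g (fun r => t^-1 * fine (beta r (m r))
  + (1 - t^-1) * fine (beta r (q r)))%R) => //.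
- apply: measurableT_comp => //; exact: measurable_fun_beta_comp.
- move=> r; rewrite pg andbT -(ler_pM2l t0).
  have -> : (t * (t^-1 * fine (beta r (m r)) + (1 - t^-1) * fine (beta r (q r)))
    = fine (beta r (m r)) + (t - 1) * fine (beta r (q r)))%R by field.
  by have := bm r; lra.
- apply: affine_mix_integrable => //; exact: adm_cost am.
Qed.

Lemma admissible_mix p q t : admissible p -> admissible q ->
  (0 <= t <= 1)%R -> exists m, [/\ admissible m,
    mass m = (t * mass p + (1 - t) * mass q)%R,
    moment m = (t * moment p + (1 - t) * moment q)%R &
    (cost m <= t * cost p + (1 - t) * cost q)%R].
Proof.
move=> [mp p_ge0 fp ip iXp ibp] [mq q0 fq iq iXq ibq] t01.
pose m r := (t * p r + (1 - t) * q r)%R; exists m.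
have /andP[t0 t1] := t01.
have m0 r : (0 <= m r)%R by apply: addr_ge0; rewrite mulr_ge0// subr_ge0.
have fm r : beta r (m r) \is a fin_num by exact: beta_mix_fin.
have bm r : (fine (beta r (m r)) <=
    t * fine (beta r (p r)) + (1 - t) * fine (beta r (q r)))%R.
  exact: fine_beta_convex.
have XmE : (fun r => X r * m r)%R =
    (fun r => t * (X r * p r) + (1 - t) * (X r * q r))%R.
  by apply/funext => r; rewrite /m; ring.
have am : admissible m.
  apply: (@admissible_of_le m (fun r => t * fine (beta r (p r))
    + (1 - t) * fine (beta r (q r)))%R) => //.
  - by apply: measurable_funD; apply: measurable_funM.
  - exact: affine_mix_integrable.
  - have := affine_mix_integrable t iXp iXq.
    by apply: eq_integrable => // r _ /=; congr EFin; rewrite /m; ring.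
  - exact: affine_mix_integrable.
split=> //.
- by rewrite /mass -Rintegral_mix.
- by rewrite /moment XmE Rintegral_mix.
- rewrite /cost -Rintegral_mix//; apply: le_Rintegral => //.
    exact: adm_cost am.
  exact: affine_mix_integrable.
Qed.

(** Were all moments at least [b], a multiplier for the mass constraint and the
    interchange of supremum and integral would bound [X] from below by [b]
    almost everywhere. *)
Lemma moment_lt b : ess_lb mu X < b%:E ->
  exists p, [/\ admissible p, mass p = 1%R & (moment p < b)%R].
Proof.
move=> mb; apply: contrapT => hn.
have hmom p : admissible p -> mass p = 1%R -> (b <= moment p)%R.
  by move=> ap p1; rewrite leNgt; apply/negP => lt; apply: hn; exists p.
have [| | | |nu hnu] := @lagrange_multiplier R (T -> R) admissible
    (fun p => moment p - b)%R (fun p => mass p - 1)%R.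
- move=> p q t ap aq t01; have [m [am m1 m2 _]] := admissible_mix ap aq t01.
  by exists m; split=> //; rewrite ?m1 ?m2; [ring|lra].
- by have [p ap lt] := mass_lt1; exists p; rewrite ?subr_lt0.
- by have [p ap gt] := mass_gt1; exists p; rewrite ?subr_gt0.
- by move=> p ap /subr0_eq p1; rewrite subr_ge0 hmom.
have hlag p : admissible p -> (lagrangian (- nu) (-1) 0 p <= - b - nu)%R.
  by move=> ap; have := hnu _ ap; rewrite /lagrangian; lra.
pose S r := ereal_sup (range (fun n => (posrat n * (- nu - X r))%:E)).
have SE r : ereal_sup (range (fun n =>
    (integrand (- nu) (-1) 0 r (posrat n))%:E)) = S r.
  rewrite /S; suff -> : (fun n => (integrand (- nu) (-1) 0 r (posrat n))%:E) =
    (fun n => (posrat n * (- nu - X r))%:E) by [].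
  by apply/funext => n; rewrite /integrand; congr EFin; ring.
have intS : \int[mu]_r S r <= (- b - nu)%:E.
  have := integral_sup_le hbeta hX (ex_intro _ p0 adm0) hlag.
  by under eq_integral do rewrite SE.
have S0 r : 0 <= S r by exact: sup_posrat_ge0.
have bnu : (b <= - nu)%R.
  have : 0 <= (- b - nu)%:E by apply: le_trans intS; exact: integral_ge0.
  by rewrite lee_fin; lra.
have iS : mu.-integrable [set: T] S.
  apply/integrableP; split.
    apply: measurable_ereal_sup_seq => n; apply/measurable_EFinP.
    by apply: measurable_funM => //; exact: measurable_funB.
  under eq_integral do rewrite gee0_abs//.
  by apply: le_lt_trans intS _; rewrite ltry.
have : b%:E <= ess_lb mu X.
  apply/ess_infP; apply: filterS (integrable_ae measurableT iS) => r /(_ I) Sr.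
  rewrite lee_fin; apply: le_trans bnu _; rewrite leNgt; apply/negP => lt.
  by move: Sr; rewrite /S sup_posrat_pinfty// subr_gt0.
by rewrite leNgt mb.
Qed.

(** Multipliers for the two constraints, found one after the other: the
    moment constraint on the functions of mass one, then the mass
    constraint. *)
Lemma dual_multipliers b c :
  (exists p, [/\ admissible p, mass p = 1%R & (moment p < b)%R]) ->
  (exists p, [/\ admissible p, mass p = 1%R & (b < moment p)%R]) ->
  (forall p, admissible p -> mass p = 1%R -> moment p = b -> (c <= cost p)%R) ->
  exists t1 t2, forall p, admissible p ->
    (lagrangian t1 t2 1 p <= t1 + t2 * b - c)%R.
Proof.
move=> [p1 [ap1 mp1 lt1]] [p2 [ap2 mp2 lt2]] hc.
have [| | | |lam hlam] := @lagrange_multiplier R (T -> R)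
    [set p | admissible p /\ mass p = 1%R]
    (fun p => cost p - c)%R (fun p => moment p - b)%R.
- move=> p q t [ap p1'] [aq q1] t01.
  have [m [am m1 m2 m3]] := admissible_mix ap aq t01.
  exists m; split; [split=> //; rewrite m1 p1' q1; ring|rewrite m2; ring|].
  by move: m3; lra.
- by exists p1 => //; rewrite subr_lt0.
- by exists p2 => //; rewrite subr_gt0.
- by move=> p [ap m1] /subr0_eq pb; rewrite subr_ge0 hc.
have [| | | |nu hnu] := @lagrange_multiplier R (T -> R) admissible
    (fun p => cost p - c + lam * (moment p - b))%R (fun p => mass p - 1)%R.
- move=> p q t ap aq t01; have [m [am m1 m2 m3]] := admissible_mix ap aq t01.
  by exists m; split=> //; rewrite ?m1 ?m2; [ring|lra].
- by have [p ap lt] := mass_lt1; exists p; rewrite ?subr_lt0.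
- by have [p ap gt] := mass_gt1; exists p; rewrite ?subr_gt0.
- by move=> p ap /subr0_eq m1; apply: hlam.
exists (- nu)%R, (- lam)%R => p ap; have := hnu p ap.
rewrite /lagrangian; lra.
Qed.

(** * The functions K and G *)

Lemma conj_integrandE t1 t2 r : conj_beta beta r (t1 + t2 * X r)%R =
  ereal_sup (range (fun n => (integrand t1 t2 1 r (posrat n))%:E)).
Proof. exact: conj_betaE. Qed.

Lemma measurable_conj t1 t2 : measurable_fun [set: T]
  (fun r => conj_beta beta r (t1 + t2 * X r)%R).
Proof.
under eq_fun do rewrite conj_integrandE.
apply: measurable_ereal_sup_seq => n; apply/measurable_EFinP.
exact: measurable_integrand.
Qed.

Lemma integrand_le_conj t1 t2 p r : admissible p ->
  (integrand t1 t2 1 r (p r))%:E <= conj_beta beta r (t1 + t2 * X r)%R.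
Proof.
move=> ap; apply: le_trans (young _ _ (p r) _).
by rewrite /integrand mul1r EFinB fineK//; exact: adm_fin ap r.
Qed.

Lemma conj_integral_exists t1 t2 :
  integral_exists mu (fun r => conj_beta beta r (t1 + t2 * X r)%R).
Proof.
right; have i0 := integrable_integrand t1 t2 1 adm0.
apply: le_lt_trans (integral_funeneg_lt_pinfty measurableT i0).
apply: ae_le_integral_measurable; try apply: measurable_funeneg.
- exact: measurable_conj.
- exact: measurable_int i0.
apply: nearW => r; rewrite !funenegE ge_max !le_max lexx orbT andbT leeN2.
by rewrite integrand_le_conj.
Qed.

Lemma K_integral t1 t2 :
  K mu beta X t1 t2 = \int[mu]_r conj_beta beta r (t1 + t2 * X r)%R.
Proof.
by rewrite /K /upper_integral asboolT//; exact: conj_integral_exists.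
Qed.

Lemma K_ge t1 t2 p : admissible p ->
  (lagrangian t1 t2 1 p)%:E <= K mu beta X t1 t2.
Proof.
move=> ap; rewrite K_integral -integral_integrand//.
apply: ae_le_integral_measurable.
- exact: measurable_int (integrable_integrand t1 t2 1 ap).
- exact: measurable_conj.
- by apply: nearW => r; exact: integrand_le_conj.
Qed.

Lemma K_le t1 t2 C :
  (forall p, admissible p -> (lagrangian t1 t2 1 p <= C)%R) ->
  K mu beta X t1 t2 <= C%:E.
Proof.
move=> hC; rewrite K_integral; under eq_integral do rewrite conj_integrandE.
by apply: integral_sup_le => //; exists p0.
Qed.

Lemma K_gtNy t1 t2 : -oo < K mu beta X t1 t2.
Proof. by apply: lt_le_trans (K_ge t1 t2 adm0); rewrite ltNyr. Qed.

Lemma K_fin t1 t2 : K mu beta X t1 t2 < +oo -> K mu beta X t1 t2 \is a fin_num.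
Proof. by move=> Ky; rewrite fin_numE gt_eqF ?K_gtNy//= lt_eqF. Qed.

Lemma conj_integrable t1 t2 : K mu beta X t1 t2 < +oo ->
  mu.-integrable [set: T] (fun r => conj_beta beta r (t1 + t2 * X r)%R).
Proof.
move=> Ky; apply: integrable_of_integral; first exact: measurable_conj.
  exact: conj_integral_exists.
by rewrite -K_integral K_fin.
Qed.

Lemma dual_KV_EFin k t1 t2 : (t2 < 0)%R -> K mu beta X t1 t2 < +oo ->
  dual_KV mu beta X k t1 t2 =
    ((k + fine (K mu beta X t1 t2) - t1) / t2)%:E.
Proof.
move=> t20 /K_fin Kf; rewrite /dual_KV inver lt_eqF//.
by have /fineK := Kf; set kappa := fine _ => <-.
Qed.

Lemma dual_KV_Ny k t1 t2 : (t2 < 0)%R -> K mu beta X t1 t2 = +oo ->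
  dual_KV mu beta X k t1 t2 = -oo.
Proof.
move=> t20 KEy; rewrite /dual_KV KEy inver lt_eqF//.
by rewrite addey// addye// lt0_mulye// lte_fin invr_lt0.
Qed.

(** The integrated Young inequality. As the expectation of [X] under [p] may be
    infinite, the integrals compared are those of [X * p] and of an integrable
    lower bound of it. *)
Lemma weak_duality k t1 t2 p : (t2 < 0)%R -> density mu p ->
  H mu beta p <= k%:E ->
  dual_KV mu beta X k t1 t2 <= \int[mu]_r (X r * p r)%:E.
Proof.
move=> t20 dp Hk; have [Ky|] := ltP (K mu beta X t1 t2) +oo; last first.
  by rewrite leye_eq => /eqP /(dual_KV_Ny k t20) ->; rewrite leNye.
have Hy : H mu beta p < +oo by apply: le_lt_trans Hk _; rewrite ltry.
have ib := density_integrable dp Hy; have [mp p_ge0 p1] := dp.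
have ip : mu.-integrable [set: T] (fun r => (p r)%:E).
  apply: integrable_of_integral; first exact/measurable_EFinP.
    right; rewrite (_ : _^\- = cst 0) ?integral0 ?ltry//.
    apply/funext => r; rewrite funenegE /=; apply/max_idPr.
    by rewrite lee_fin oppr_le0.
  by rewrite p1.
have ic := conj_integrable Ky.
rewrite dual_KV_EFin//.
pose g r := conj_beta beta r (t1 + t2 * X r)%R + beta r (p r)
            + (- t1)%:E * (p r)%:E.
have i1 : mu.-integrable [set: T]
    (fun r => conj_beta beta r (t1 + t2 * X r)%R + beta r (p r)).
  exact: integrableD.
have i2 := integrableZl measurableT (- t1)%R ip.
have ig : mu.-integrable [set: T] g by exact: integrableD.
have intg : \int[mu]_r g r <= (k + fine (K mu beta X t1 t2) - t1)%:E.
  rewrite integralD// integralD// integralZl// p1 mule1 -K_integral.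
  have HE : H mu beta p = \int[mu]_r beta r (p r).
    exact: upper_integral_integrable.
  rewrite -HE; have /fineK := K_fin Ky; set kappa := fine _ => <-.
  apply: (@le_trans _ _ (kappa%:E + k%:E + (- t1)%:E)).
    by rewrite leeD2r// leeD2l.
  by rewrite -!EFinD lee_fin; lra.
have ig' := integrableZl measurableT t2^-1 ig.
apply: (@le_trans _ _ (\int[mu]_r ((t2^-1)%:E * g r))).
  rewrite integralZl//; move: intg.
  rewrite -(fineK (integrable_fin_num measurableT ig)) !lee_fin mulrC => intg.
  by rewrite ler_nM2l// invr_lt0.
apply: ae_le_integral_measurable; first exact: measurable_int ig'.
  by apply/measurable_EFinP; exact: measurable_funM.
have fb := integrable_ae measurableT ib.
have fc := integrable_ae measurableT ic.
apply: filterS2 fb fc => r /(_ I) fb /(_ I) fc.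
have := young beta r (p r) (t1 + t2 * X r)%R.
rewrite /g -(fineK fb) -(fineK fc); set b := fine _; set cc := fine _ => h.
suff : (t2^-1 * (cc + b - t1 * p r) <= X r * p r)%R.
  by rewrite -lee_fin EFinM EFinB EFinD EFinM EFinN mulNe.
move: h; rewrite -EFinB lee_fin => h.
rewrite -(ler_nM2l t20) mulVKf ?lt_eqF//; move: h; lra.
Qed.

(** The infimum over [t1] equals, up to sign, the infimum of
    [cost - t2 * moment] over the functions of mass one, and a multiplier of
    the mass constraint attains it. *)
Lemma K_minimum t2 : exists t1, forall u,
  K mu beta X t1 t2 - t1%:E <= K mu beta X u t2 - u%:E.
Proof.
have [[u0 Ku0]|hn] := pselect (exists u, K mu beta X u t2 < +oo); last first.
  exists 0%R => u; suff -> : K mu beta X u t2 = +oo by rewrite addye// leey.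
  by apply/eqP; rewrite -leye_eq leNgt; apply/negP => Ku; apply: hn; exists u.
pose A := [set (cost p - t2 * moment p)%R | p in
  [set p | admissible p /\ mass p = 1%R]].
have lbA u : K mu beta X u t2 < +oo ->
    lbound A (u - fine (K mu beta X u t2))%R.
  move=> Ku _ [p [ap p1] <-]; have := K_ge u t2 ap.
  rewrite -{1}(fineK (K_fin Ku)) lee_fin /lagrangian p1; lra.
have A0 : A !=set0 by exists (cost p0 - t2 * moment p0)%R, p0.
have infA : has_inf A by split=> //; eexists; exact: lbA Ku0.
have [| | | |nu hnu] := @lagrange_multiplier R (T -> R) admissible
    (fun p => cost p - t2 * moment p - inf A)%R (fun p => mass p - 1)%R.
- move=> p q t ap aq t01; have [m [am m1 m2 m3]] := admissible_mix ap aq t01.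
  by exists m; split=> //; rewrite ?m1 ?m2; [ring|lra].
- by have [p ap lt] := mass_lt1; exists p; rewrite ?subr_lt0.
- by have [p ap gt] := mass_gt1; exists p; rewrite ?subr_gt0.
- move=> p ap /subr0_eq p1; rewrite subr_ge0.
  apply: ge_inf; first exact: infA.2.
  by exists p.
have Knu : K mu beta X (- nu) t2 <= (- nu - inf A)%:E.
  by apply: K_le => p ap; have := hnu p ap; rewrite /lagrangian; lra.
exists (- nu)%R => u; have [Ku|] := ltP (K mu beta X u t2) +oo; last first.
  by rewrite leye_eq => /eqP ->; rewrite addye// leey.
apply: (@le_trans _ _ (- inf A)%:E).
  by rewrite leeBlDr// -EFinD addrC.
have := lb_le_inf A0 (lbA u Ku).
rewrite -{2}(fineK (K_fin Ku)) -EFinB lee_fin; lra.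
Qed.

Lemma G_attained t2 : exists2 t1, G mu beta X t2 = K mu beta X t1 t2 - t1%:E &
  forall u, K mu beta X t1 t2 - t1%:E <= K mu beta X u t2 - u%:E.
Proof.
have [t1 ht1] := K_minimum t2; exists t1 => //.
apply/eqP; rewrite eq_le; apply/andP; split.
  by apply: ereal_inf_lbound; exists t1.
by apply: le_ereal_inf_tmp => _ [u _ <-].
Qed.

Lemma dual_anti (t2 : R) (x y : \bar R) : (t2 < 0)%R -> x <= y ->
  y / t2%:E <= x / t2%:E.
Proof.
move=> t20 xy; rewrite inver lt_eqF//.
rewrite -[t2^-1%R]opprK EFinN !muleN leeN2 lee_wpmul2r//.
by rewrite lee_fin oppr_ge0 invr_le0 ltW.
Qed.

Lemma G_maximises_dual k t2 : (t2 < 0)%R ->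
  is_max [set: R] (fun t1 => dual_KV mu beta X k t1 t2)
    (dual_GV mu beta X k t2).
Proof.
move=> t20; have [t1 GE ht1] := G_attained t2.
exists t1; last by rewrite /dual_KV /dual_GV GE addeA.
split=> // u _; rewrite /dual_KV -2!addeA; apply: dual_anti => //.
by rewrite leeD2l.
Qed.

(** * The value of the problem *)

Section Value.
Variable k : R.
Hypotheses (cost0 : cost p0 = 0%R) (k0 : (0 < k)%R).

Lemma V_le p : admissible p -> mass p = 1%R -> (cost p <= k)%R ->
  V mu beta X k <= (moment p)%:E.
Proof.
move=> ap p1 pk; have [dp [mp Hp]] := admissible_density ap p1.
apply: ereal_inf_lbound; exists p => //; split=> //.
  by rewrite Hp lee_fin.
exact: integral_exists_integrable (adm_moment ap).
Qed.

(** Slack in the cost constraint is spent on lowering the moment. *)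
Lemma V_lt p : admissible p -> mass p = 1%R -> (cost p < k)%R ->
  ess_lb mu X < (moment p)%:E -> V mu beta X k < (moment p)%:E.
Proof.
move=> ap p1 pk /moment_lt[q [aq q1 qp]].
pose D := (`|cost q - cost p|)%R; pose e := (k - cost p)%R.
have e0 : (0 < e)%R by rewrite subr_gt0.
have D0 : (0 <= D)%R by exact: normr_ge0.
have eD : (0 < e + D)%R by rewrite ltr_wpDr.
pose t := (e / (e + D))%R.
have t0 : (0 < t)%R by rewrite divr_gt0.
have t01 : (0 <= t <= 1)%R.
  by apply/andP; split; [exact: ltW|rewrite ler_pdivrMr// mul1r lerDl].
have [m [am m1 m2 m3]] := admissible_mix aq ap t01.
apply: (@le_lt_trans _ _ (moment m)%:E).
  apply: V_le => //; first by rewrite m1 q1 p1; ring.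
  apply: le_trans m3 _.
  have h1 : (t * (cost q - cost p) <= t * D)%R.
    by rewrite ler_pM2l// ler_norm.
  have h2 : (t * D <= e)%R.
    rewrite /t mulrAC ler_pdivrMr// mulrDr lerDr.
    by rewrite mulr_ge0// ltW.
  by move: h1 h2; rewrite /e; lra.
rewrite m2 lte_fin.
have : (0 < t * (moment p - moment q))%R by rewrite mulr_gt0 ?subr_gt0.
lra.
Qed.

Lemma dual_KV_le_V t1 t2 : (t2 < 0)%R ->
  dual_KV mu beta X k t1 t2 <= V mu beta X k.
Proof.
move=> t20; apply: le_ereal_inf_tmp => _ [p [dp Hp _] <-].
exact: weak_duality.
Qed.

(** The second multiplier is negative because the reference density, of cost
    [0 < k], lies above the level [b]. *)
Lemma negative_multipliers b : ess_lb mu X < b%:E -> (b < moment p0)%R ->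
  (forall p, admissible p -> mass p = 1%R -> moment p = b -> (k <= cost p)%R) ->
  exists t1 t2, (t2 < 0)%R /\ K mu beta X t1 t2 <= (t1 + t2 * b - k)%:E.
Proof.
move=> mb bb0 hk; have [| | |t1 [t2 ht]] := @dual_multipliers b k => //.
- exact: moment_lt.
- by exists p0.
exists t1, t2; split; last exact: K_le.
have := ht p0 adm0; rewrite /lagrangian mass0 cost0 => h.
rewrite -(pmulr_llt0 _ (_ : 0 < moment p0 - b)%R) ?subr_gt0//.
by move: h k0; rewrite mulrBr; lra.
Qed.

Lemma dual_KV_ge b t1 t2 : (t2 < 0)%R ->
  K mu beta X t1 t2 <= (t1 + t2 * b - k)%:E ->
  b%:E <= dual_KV mu beta X k t1 t2.
Proof.
move=> t20 hK; have Ky : K mu beta X t1 t2 < +oo.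
  by apply: le_lt_trans hK _; rewrite ltry.
rewrite dual_KV_EFin// lee_fin ler_ndivlMr//.
by move: hK; rewrite -{1}(fineK (K_fin Ky)) lee_fin; lra.
Qed.

(** The dual value at [b] bounds [V] from below, also against the densities
    whose expectation of [X] is [-oo], which a convex combination with [p0]
    would not bring back to [b]. *)
Lemma V_ge b : ess_lb mu X < b%:E -> (b < moment p0)%R ->
  k%:E < F mu beta X b -> b%:E <= V mu beta X k.
Proof.
move=> mb bb0 hF; have [|t1 [t2 [t20 hK]]] := negative_multipliers mb bb0.
  move=> p ap p1 pb; rewrite -lee_fin; apply: ltW; apply: lt_le_trans hF _.
  have [dp [mp Hp]] := admissible_density ap p1.
  by apply: ereal_inf_lbound; exists p => //; split=> //; rewrite mp pb.
exact: le_trans (dual_KV_ge t20 hK) (dual_KV_le_V _ t20).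
Qed.

Section Finite.
Variable b : R.
Hypotheses (VE : V mu beta X k = b%:E) (mb : ess_lb mu X < b%:E).
Hypothesis bb0 : (b < moment p0)%R.

(** By [V_lt] no density of moment [b] costs less than [k], so [k] is a valid
    level for the multipliers at [b]. *)
Lemma V_dual_attained : exists t1 t2, (t2 < 0)%R /\
  K mu beta X t1 t2 <= (t1 + t2 * b - k)%:E.
Proof.
apply: negative_multipliers => // p ap p1 pb; rewrite leNgt; apply/negP => lt.
by have := V_lt ap p1 lt; rewrite pb VE ltxx => /(_ mb).
Qed.

(** The Young inequality, integrated against densities of cost at most [k]
    whose moments tend to [b]. *)
Lemma K_ge_value t1 t2 : (t1 + t2 * b - k)%:E <= K mu beta X t1 t2.
Proof.
apply/lee_addgt0Pr => e e0.
have a0 : (0 < e / (`|t2| + 1))%R by rewrite divr_gt0// ltr_wpDl.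
have : V mu beta X k < (b + e / (`|t2| + 1))%:E.
  by rewrite VE lte_fin ltrDl.
move=> /ereal_inf_lt[_ [p [dp Hp ex] <-] lt].
have ge : b%:E <= \int[mu]_r (X r * p r)%:E.
  by rewrite -VE; apply: ereal_inf_lbound; exists p.
have [mp p_ge0 _] := dp.
have iX : mu.-integrable [set: T] (fun r => (X r * p r)%:E).
  apply: integrable_of_integral => //.
    by apply/measurable_EFinP; exact: measurable_funM.
  rewrite fin_numE gt_eqF ?lt_eqF//=.
    by apply: lt_trans lt _; rewrite ltry.
  by apply: lt_le_trans ge; rewrite ltNyr.
have [|q [aq q1 qm qc]] := density_admissible dp _ iX.
  by apply: le_lt_trans Hp _; rewrite ltry.
move: lt ge Hp; rewrite -qm -qc lte_fin !lee_fin => lt ge Hp.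
have := K_ge t1 t2 aq; rewrite -(leeD2rE _ _ (_ : e%:E \is a fin_num))//.
apply: le_trans; rewrite -EFinD lee_fin /lagrangian q1.
have : (- (t2 * (moment q - b)) <= e)%R.
  apply: (@le_trans _ _ (`|t2| * (e / (`|t2| + 1)))%R).
    rewrite -mulNr; apply: (@le_trans _ _ (`|t2| * (moment q - b))%R).
      by rewrite ler_wpM2r ?subr_ge0// (le_trans (ler_norm _))// normrN.
    by rewrite ler_wpM2l//; lra.
  rewrite mulrCA -[leRHS]mulr1 ler_pM2l// ler_pdivrMr ?ltr_wpDl//.
  by rewrite mul1r lerDl.
lra.
Qed.

Lemma G_ge_value t2 : (t2 * b - k)%:E <= G mu beta X t2.
Proof.
apply: le_ereal_inf_tmp => _ [t1 _ <-]; rewrite leeBrDr// -EFinD.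
by rewrite (_ : _ + _ = t1 + t2 * b - k)%R ?K_ge_value//; ring.
Qed.

Lemma value_slope_lt0 t1 t2 : K mu beta X t1 t2 = (t1 + t2 * b - k)%:E ->
  (t2 < 0)%R.
Proof.
move=> KEb; have := K_ge t1 t2 adm0.
rewrite KEb lee_fin /lagrangian mass0 cost0 => h.
rewrite -(pmulr_llt0 _ (_ : 0 < moment p0 - b)%R) ?subr_gt0//.
by move: h k0; rewrite mulrBr; lra.
Qed.

Lemma dual_KV_eq t1 t2 : (t2 < 0)%R ->
  dual_KV mu beta X k t1 t2 = b%:E <->
  K mu beta X t1 t2 = (t1 + t2 * b - k)%:E.
Proof.
move=> t20; split=> [h|KEb].
  have [Ky|] := ltP (K mu beta X t1 t2) +oo; last first.
    by rewrite leye_eq => /eqP /(dual_KV_Ny k t20); rewrite h.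
  move: h; rewrite dual_KV_EFin// => -[] h.
  have : (k + fine (K mu beta X t1 t2) - t1 = b * t2)%R.
    by rewrite -h divfK// lt_eqF.
  by move=> e; rewrite -(fineK (K_fin Ky)); congr EFin; lra.
rewrite dual_KV_EFin ?KEb ?ltry//=; congr EFin.
by field; rewrite lt_eqF.
Qed.

Lemma dual_GV_eq t2 : (t2 < 0)%R ->
  dual_GV mu beta X k t2 = b%:E <-> G mu beta X t2 = (t2 * b - k)%:E.
Proof.
move=> t20; have [t1 GE _] := G_attained t2.
have -> : dual_GV mu beta X k t2 = dual_KV mu beta X k t1 t2.
  by rewrite /dual_GV /dual_KV GE addeA.
rewrite dual_KV_eq// GE; split=> [->|].
  by rewrite -EFinB; congr EFin; ring.
move=> h; have Kf : K mu beta X t1 t2 \is a fin_num.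
  apply: K_fin; rewrite ltNge leye_eq; apply/negP => /eqP KEy.
  by move: h; rewrite KEy.
move: h; rewrite -(fineK Kf) -EFinB => -[] h; congr EFin; lra.
Qed.

End Finite.
End Value.

(** * Optimal multipliers *)

(** Optimality in the first coordinate bounds the left difference quotients of
    [K] by one. By Fatou's lemma the same bound holds for the integral of the
    left derivative of the conjugate, which is infinite at the end of the domain
    of the conjugate and dominates [p_theta] before it. *)
Lemma optimal_Theta t1 t2 : K mu beta X t1 t2 < +oo ->
  (forall h, (0 < h)%R ->
    K mu beta X t1 t2 <= K mu beta X (t1 - h) t2 + h%:E) ->
  Theta mu beta X (t1, t2) /\
  \int[mu]_r (p_theta beta X (t1, t2) r)%:E <= 1.
Proof.
move=> Ky hopt; pose tau r := (t1 + t2 * X r)%R.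
pose cj h r := conj_beta beta r (tau r - h)%R.
have cjE h : cj h = (fun r => conj_beta beta r (t1 - h + t2 * X r)%R).
  by apply/funext => r; rewrite /cj /tau; congr conj_beta; ring.
have Khy h : (0 <= h)%R -> K mu beta X (t1 - h) t2 < +oo.
  move=> h0; apply: le_lt_trans Ky; rewrite !K_integral.
  apply: ae_le_integral_measurable; try exact: measurable_conj.
  by apply: nearW => r; apply: conj_beta_le => //; rewrite lerD2r gerBl.
have icj h : (0 <= h)%R -> mu.-integrable [set: T] (cj h).
  by move=> h0; rewrite cjE; apply: conj_integrable; exact: Khy.
have ic : mu.-integrable [set: T] (fun r => conj_beta beta r (tau r)).
  exact: conj_integrable.
pose e n : R := n.+1%:R^-1%R.
have e0 n : (0 < e n)%R by rewrite invr_gt0.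
pose q n r :=
  (n.+1%:R * (fine (conj_beta beta r (tau r)) - fine (cj (e n) r)))%R.
pose Q n r := Order.max (q n r)%:E 0.
have mq n : measurable_fun [set: T] (fun r => (q n r)%:E).
  apply/measurable_EFinP; apply: measurable_funM => //.
  apply: measurable_funB; apply: measurableT_comp => //.
    exact: measurable_int ic.
  exact: measurable_int (icj _ (ltW (e0 n))).
have mQ n : measurable_fun [set: T] (Q n) by exact: measurable_maxe.
have Q0 n r : 0 <= Q n r by rewrite le_max lexx orbT.
have fc := integrable_ae measurableT ic.
have fcj r h : (0 <= h)%R -> conj_beta beta r (tau r) \is a fin_num ->
    cj h r \is a fin_num.
  move=> h0 fr; rewrite fin_numE gt_eqF ?conj_beta_gtNy//= lt_eqF//.
  apply: (@le_lt_trans _ _ (conj_beta beta r (tau r))).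
    by apply: conj_beta_le => //; rewrite gerBl.
  by rewrite -(fineK fr) ltry.
have q0 n r : conj_beta beta r (tau r) \is a fin_num -> (0 <= q n r)%R.
  move=> fr; rewrite mulr_ge0// subr_ge0 -lee_fin !fineK//.
    by apply: conj_beta_le => //; rewrite gerBl ltW.
  by apply: fcj => //; exact: ltW.
have intQ n : \int[mu]_r Q n r <= 1.
  have iB := integrableB measurableT ic (icj _ (ltW (e0 n))).
  apply: (@le_trans _ _
    (\int[mu]_r (n.+1%:R%:E * (conj_beta beta r (tau r) - cj (e n) r)))).
    apply: ae_le_integral_measurable => //.
      exact: measurable_int (integrableZl measurableT n.+1%:R iB).
    apply: filterS fc => r /(_ I) fr; rewrite /Q max_l ?lee_fin ?q0//.
    have fr' := fcj r (e n) (ltW (e0 n)) fr.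
    by rewrite /q -(fineK fr) -(fineK fr') -EFinB -EFinM.
  rewrite integralZl// (integralB measurableT ic (icj _ (ltW (e0 n)))).
  rewrite -K_integral cjE -K_integral.
  have := hopt (e n) (e0 n).
  have := K_fin Ky; have := K_fin (Khy _ (ltW (e0 n))).
  move=> /fineK; set y := fine _ => <-; move=> /fineK; set x := fine _ => <-.
  rewrite -EFinD -EFinB -EFinM !lee_fin => h.
  apply: (@le_trans _ _ (n.+1%:R * e n)%R); last by rewrite divff.
  by rewrite ler_pM2l//; lra.
pose L r := limn_einf (Q ^~ r).
have mL : measurable_fun [set: T] L by exact: measurable_limn_einf.
have L0 r : 0 <= L r by apply: le_limn_einf; apply: nearW => n.
have intL : \int[mu]_r L r <= 1.
  apply: le_trans (fatou mu measurableT mQ (fun n r _ => Q0 n r)) _.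
  rewrite limn_einf_lim; apply: lime_le; first exact: is_cvg_einfs.
  near=> n; apply: le_trans (intQ n); apply: ereal_inf_lbound.
  by exists n => /=.
have iL : mu.-integrable [set: T] L.
  apply/integrableP; split=> //.
  under eq_integral do rewrite gee0_abs//.
  by apply: le_lt_trans intL _; rewrite ltry.
have fL := integrable_ae measurableT iL.
have LE r : conj_beta beta r (tau r) \is a fin_num ->
    L r = limn_einf (fun n => (q n r)%:E).
  move=> fr; congr limn_einf; apply/funext => n.
  by rewrite /Q max_l// lee_fin q0.
split.
  split; first exact: Ky.
  apply: filterS2 fc fL => r /(_ I) fr /(_ I) fLr /=.
  rewrite ltNge; apply/negP => le_tau.
  (* Any slope beyond [L r] gives the contradiction. *)
  pose S := (fine (L r) + 1)%R.
  have S0 : (0 < S)%R by rewrite ltr_wpDl// fine_ge0.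
  have [del del0 steep] := conj_beta_steep hbeta S0 fr le_tau.
  have : S%:E <= L r.
    rewrite LE//; apply: le_limn_einf; near=> n; rewrite lee_fin.
    have small : (0 < e n < del)%R.
      rewrite e0/=; near: n; have := @cvg_harmonic R.
      by move/cvgr_lt => /(_ _ del0).
    rewrite -(ler_pM2l (e0 n)) mulrC mulrA mulVf ?mul1r//.
    exact: steep small.
  by rewrite -(fineK fLr) lee_fin /S; lra.
apply: le_trans intL; apply: ae_le_integral_nonneg => //.
apply: filterS fc => r /(_ I) fr; rewrite LE//.
exact: conj_beta'_le_quotients.
Unshelve. all: by end_near. Qed.

End ReferenceDensity.
End Model.

(** * The duality theorem *)

Lemma maximiserP {R : realType} {A : Type} (D : set A) (f : A -> \bar R)
    (v : \bar R) : (exists2 x, D x & f x = v) -> (forall x, D x -> f x <= v) ->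
  forall x, maximiser D f x <-> D x /\ f x = v.
Proof.
move=> [x0 Dx0 fx0] fv x; split=> [[Dx xmax]|[Dx fx]]; split=> //.
  by apply/eqP; rewrite eq_le fv//= -fx0 xmax.
by move=> y Dy; rewrite fx fv.
Qed.

(** If the limit defining [kmax] failed to exist, it would have the default
    value [0], which is below [k]; so it exists, and [F] exceeds [k] close to
    the essential infimum. *)
Lemma kmax_witness {d} {T : measurableType d} {R : realType}
    (mu : {measure set T -> \bar R}) (beta : T -> R -> \bar R) (X : T -> R)
    (k c : R) : (0 < k)%R -> k%:E < kmax mu beta X -> ess_lb mu X < c%:E ->
  exists b, [/\ ess_lb mu X < b%:E, (b < c)%R & k%:E < F mu beta X b].
Proof.
move=> k0; rewrite /kmax; case: (ess_lb mu X) => [m| |] hk mc; last 2 first.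
- by move: mc; rewrite ltNge leey.
- have [cv|ncv] := pselect (cvg (F mu beta X b @[b --> -oo%R])); last first.
    by move: hk; rewrite dvgP// lte_fin ltNge (ltW k0).
  have near_k : \forall b \near -oo%R, k%:E < F mu beta X b.
    exact: cv _ (open_ereal_gt' hk).
  have near_c : \forall b \near -oo%R, (b < c)%R by exact: nbhs_ninfty_lt.
  have [b [/= kb bc]] := filter_ex (filterI near_k near_c).
  by exists b; split=> //; rewrite ltNyr.
- have [cv|ncv] := pselect (cvg (F mu beta X b @[b --> m^'+])); last first.
    by move: hk; rewrite dvgP// lte_fin ltNge (ltW k0).
  have near_k : \forall b \near m^'+, k%:E < F mu beta X b.
    exact: cv _ (open_ereal_gt' hk).
  have near_m : \forall b \near m^'+, (m < b)%R by exact: nbhs_right_gt.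
  have near_c : \forall b \near m^'+, (b < c)%R by exact: nbhs_right_lt.
  have near_all : \forall b \near m^'+, [/\ (m < b)%R, (b < c)%R &
      k%:E < F mu beta X b] by near=> b; split; near: b.
  have [b [? ? ?]] := @filter_ex _ _ (at_right_proper_filter m) _ near_all.
  by exists b.
Unshelve. all: by end_near. Qed.

Theorem theorem1 (d : measure_display) (T : measurableType d) (R : realType)
    (mu : {sigma_finite_measure set T -> \bar R})
    (beta : T -> R -> \bar R) (X p0 : T -> R) (k : R)
    (hbeta : convex_integrand beta)
    (hX : measurable_fun [set: T] X)
    (hp0 : density mu p0)
    (hb0 : integral_exists mu (fun r => (X r * p0 r)%:E))
    (hm : ess_lb mu X < \int[mu]_r (X r * p0 r)%:E)
    (hM : \int[mu]_r (X r * p0 r)%:E < ess_ub mu X)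
    (hH0 : H mu beta p0 = 0)
    (hH : forall p : T -> R, density mu p -> H mu beta p0 <= H mu beta p)
    (hkmax : 0 < kmax mu beta X)
    (hk0 : (0 < k)%R)
    (hk : k%:E < kmax mu beta X) :
  let b := V mu beta X k in
  let neg := [set t2 : R | (t2 < 0)%R] in
  let pair_dual := fun t : R * R => dual_KV mu beta X k t.1 t.2 in
  let neg_pairs := [set t : R * R | (t.2 < 0)%R] in
  (exists2 g : R -> \bar R,
     forall t2 : R, neg t2 ->
       is_max [set: R] (fun t1 : R => dual_KV mu beta X k t1 t2) (g t2) &
     is_max neg g b) /\
  is_max neg (dual_GV mu beta X k) b /\
  (forall t2 : R,
     maximiser neg (dual_GV mu beta X k) t2 <->
     maximiser [set: R] (fun t : R => t%:E * b - G mu beta X t) t2) /\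
  (forall t : R * R,
     maximiser neg_pairs pair_dual t <->
     maximiser [set: R * R]
       (fun u : R * R => u.1%:E + u.2%:E * b - K mu beta X u.1 u.2) t) /\
  (forall t : R * R,
     maximiser neg_pairs pair_dual t ->
     Theta mu beta X t /\
     \int[mu]_r (p_theta beta X t r)%:E <= 1).
Proof.
move=> b neg pair_dual neg_pairs.
have H_ge0 p : density mu p -> 0 <= H mu beta p by rewrite -hH0; exact: hH.
have [mp0 p0_ge0 _] := hp0.
have iX : mu.-integrable [set: T] (fun r => (X r * p0 r)%:E).
  apply: integrable_of_integral => //.
    by apply/measurable_EFinP; exact: measurable_funM.
  rewrite fin_numE; apply/andP; split.
    by rewrite gt_eqF// (le_lt_trans (leNye _) hm).
  by rewrite lt_eqF// (lt_le_trans hM (leey _)).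
have [|q0 [aq0 mass0 moment0]] := density_admissible hbeta hX H_ge0 hp0 _ iX.
  by rewrite hH0 ltry.
rewrite hH0 => -[cost0].
rewrite -moment0 in hm hM.
have [b1 [mb1 b1q0 kb1]] := kmax_witness hk0 hk hm.
have Vge : b1%:E <= b by exact: (V_ge hbeta hX H_ge0 aq0 mass0 cost0 hk0 mb1).
have Vlt : b < (moment mu X q0)%:E.
  by apply: (V_lt hbeta hX H_ge0 aq0 mass0) => //; rewrite cost0.
have fb : b \is a fin_num.
  by rewrite fin_numE gt_eqF ?lt_eqF//= ?(lt_trans Vlt) ?ltry//
    (lt_le_trans _ Vge)// ltNyr.
have VE : V mu beta X k = (fine b)%:E by rewrite fineK.
have bE : b = (fine b)%:E by rewrite fineK.
have mb : ess_lb mu X < (fine b)%:E by rewrite fineK// (lt_le_trans mb1).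
have bb0 : (fine b < moment mu X q0)%R by rewrite -lte_fin fineK.
move: (fine b) VE bE mb bb0 => v VE bE mb bb0.
have Kge := K_ge_value hbeta hX H_ge0 aq0 VE.
have Gge := G_ge_value hbeta hX H_ge0 aq0 VE.
have Kslope := value_slope_lt0 hbeta hX aq0 mass0 cost0 hk0 bb0.
have [t1 [t2 [t20 Kle]]] :=
  V_dual_attained hbeta hX H_ge0 aq0 mass0 cost0 hk0 VE mb bb0.
have Kt : K mu beta X t1 t2 = (t1 + t2 * v - k)%:E.
  by apply/eqP; rewrite eq_le Kle Kge.
have KVE u1 u2 : (u2 < 0)%R -> dual_KV mu beta X k u1 u2 = v%:E <->
    K mu beta X u1 u2 = (u1 + u2 * v - k)%:E.
  exact: (dual_KV_eq hbeta hX aq0).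
have GVE u : (u < 0)%R -> dual_GV mu beta X k u = v%:E <->
    G mu beta X u = (u * v - k)%:E.
  exact: (dual_GV_eq hbeta hX H_ge0 aq0 mass0).
have Gatt := G_attained hbeta hX H_ge0 aq0 mass0.
have KVle u1 u2 : (u2 < 0)%R -> dual_KV mu beta X k u1 u2 <= v%:E.
  by rewrite -VE; exact: (dual_KV_le_V hbeta hX H_ge0 aq0).
have Gmax u : (u < 0)%R -> is_max [set: R]
    (fun u1 => dual_KV mu beta X k u1 u) (dual_GV mu beta X k u).
  exact: (G_maximises_dual hbeta hX H_ge0 aq0 mass0).
have GVle u : (u < 0)%R -> dual_GV mu beta X k u <= v%:E.
  by move=> u0; have [u1 _ <-] := Gmax u u0; exact: KVle.
have Gt : G mu beta X t2 = (t2 * v - k)%:E.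
  apply/eqP; rewrite eq_le Gge andbT.
  apply: (@le_trans _ _ (K mu beta X t1 t2 - t1%:E)).
    by apply: ereal_inf_lbound; exists t1.
  by rewrite Kt -EFinB lee_fin; lra.
have moveE (x y : R) (g : \bar R) :
    x%:E - g = y%:E <-> g = (x - y)%:E.
  case: g => [g| |]//; rewrite -EFinB; split=> -[] e; congr EFin; lra.
have move_le (x y : R) (g : \bar R) : (x - y)%:E <= g -> x%:E - g <= y%:E.
  by case: g => [g| |]//=; rewrite -?EFinB ?lee_fin ?leNye//; lra.
have Gslope u : G mu beta X u = (u * v - k)%:E -> (u < 0)%R.
  have [u1 -> _] := Gatt u => e; apply: (Kslope u1).
  move: e; case: (K mu beta X u1 u) => [x| |]//; rewrite -EFinB => -[] e.
  by congr EFin; lra.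
have GVmax := @maximiserP _ _ neg (dual_GV mu beta X k) v%:E
  (ex_intro2 _ _ t2 t20 ((GVE _ t20).2 Gt)) GVle.
have KVmax := @maximiserP _ _ neg_pairs pair_dual v%:E
  (ex_intro2 _ _ (t1, t2) t20 ((KVE _ _ t20).2 Kt)) (fun u => KVle u.1 u.2).
have GmaxP := @maximiserP _ _ [set: R] (fun t => (t * v)%:E - G mu beta X t)
  k%:E (ex_intro2 _ _ t2 I ((moveE _ _ _).2 Gt))
  (fun u _ => move_le _ _ _ (Gge u)).
have KmaxP := @maximiserP _ _ [set: R * R]
  (fun u => (u.1 + u.2 * v)%:E - K mu beta X u.1 u.2)
  k%:E (ex_intro2 _ _ (t1, t2) I ((moveE _ _ _).2 Kt))
  (fun u _ => move_le _ _ _ (Kge u.1 u.2)).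
have max_dual : is_max neg (dual_GV mu beta X k) b.
  by rewrite bE; exists t2; [apply/GVmax; split=> //; exact/GVE|exact/GVE].
split; first by exists (dual_GV mu beta X k).
split; first exact: max_dual.
split; [|split].
- move=> u; rewrite bE; under eq_fun do rewrite -EFinM.
  split=> [/GVmax[u0 /(GVE _ u0) Gu]|/GmaxP[_ /moveE Gu]].
    by apply/GmaxP; split=> //; exact/moveE.
  have u0 := Gslope _ Gu.
  by apply/GVmax; split=> //; exact/GVE.
- move=> u; rewrite bE; under eq_fun do rewrite -EFinM -EFinD.
  split=> [/KVmax[u0 /(KVE _ _ u0) Ku]|/KmaxP[_ /moveE Ku]].
    by apply/KmaxP; split=> //; exact/moveE.
  have u0 := Kslope _ _ Ku.
  by apply/KVmax; split=> //; exact/KVE.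
- move=> [u1 u2] /KVmax[u0 /(KVE _ _ u0) Ku].
  apply: (optimal_Theta hbeta hX aq0); first by rewrite Ku ltry.
  move=> h h0; rewrite Ku; apply: le_trans (leeD2r h%:E (Kge (u1 - h)%R u2)).
  by rewrite -EFinD lee_fin /=; lra.
Qed.
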